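(* Unless the Exponential Time Hypothesis fails, the $\mathcal{C}$-Coalition Formation problem does not admit an algorithm running in time $(\mathcal{C}\cdot\mathrm{vc})^{o(\mathrm{vc}+\mathcal{C})}\, n^{\mathcal{O}(1)}$, where $n$ is the number of vertices and $\mathrm{vc}$ is the vertex cover number of the input graph.
   Context: $\mathcal{C}$-Coalition Formation (unweighted): the input is an undirected graph $G=(V,E)$ and a capacity $\mathcal{C}\in\mathbb{N}$. A $\mathcal{C}$-partition of $V$ is a partition $\mathcal{P}=\{C_1,\dots,C_p\}$ of $V$ with $|C_i|\le\mathcal{C}$ for all $i$; its value is $v(\mathcal{P})=\sum_{i=1}^p |E(G[C_i])|$. The task is to compute a $\mathcal{C}$-partition of maximum value. The Exponential Time Hypothesis (ETH) states that 3-SAT on $n$ variables and $m$ clauses cannot be solved in time $2^{o(n+m)}$. *)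

(* Defs.v *)
From HB Require Import structures.
From mathcomp Require Import all_boot.

Set Implicit Arguments.
Unset Strict Implicit.
Unset Printing Implicit Defensive.

(* Machine model: the WHILE language over binary trees (N. D. Jones,
   "Computability and Complexity from a Programming Perspective").  Every
   operator costs one unit; since trees can be stored as shared pointer
   structures and the only test is "is it a node?", this cost is polynomially
   related to the running time of Turing machines and of RAMs.  The two classes
   of running times considered below, 2^o(n+m) and
   (C * vc)^o(vc + C) * n^O(1), are closed under such polynomial overheads. *)

Inductive tree : Type := Leaf | Node of tree & tree.

Definition hd (t : tree) : tree := if t is Node l _ then l else Leaf.
Definition tl (t : tree) : tree := if t is Node _ r then r else Leaf.
Definition is_node (t : tree) : bool := if t is Node _ _ then true else false.

Inductive expr : Type :=
| EVar of nat
| ELeaf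
| ENode of expr & expr
| EHd of expr
| ETl of expr.

Inductive cmd : Type :=
| Skip
| Assign of nat & expr
| Seq of cmd & cmd
| If of expr & cmd & cmd
| While of expr & cmd.

Definition store : Type := nat -> tree.

Fixpoint eval (s : store) (e : expr) : tree :=
  match e with
  | EVar x => s x
  | ELeaf => Leaf
  | ENode e1 e2 => Node (eval s e1) (eval s e2)
  | EHd e1 => hd (eval s e1)
  | ETl e1 => tl (eval s e1)
  end.

Fixpoint ecost (e : expr) : nat :=
  match e with
  | EVar _ | ELeaf => 1
  | ENode e1 e2 => (ecost e1 + ecost e2).+1
  | EHd e1 | ETl e1 => (ecost e1).+1
  end.

Definition update (s : store) (x : nat) (v : tree) : store :=
  fun y => if y == x then v else s y.

(* exec c s s' t : started in store s, command c halts in store s' after t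
   units of time. *)
Inductive exec : cmd -> store -> store -> nat -> Prop :=
| exec_skip s : exec Skip s s 1
| exec_assign s x e :
    exec (Assign x e) s (update s x (eval s e)) (ecost e).+1
| exec_seq s1 s2 s3 c1 c2 t1 t2 :
    exec c1 s1 s2 t1 -> exec c2 s2 s3 t2 -> exec (Seq c1 c2) s1 s3 (t1 + t2)
| exec_if_true s s' e c1 c2 t :
    is_node (eval s e) -> exec c1 s s' t ->
    exec (If e c1 c2) s s' ((ecost e).+1 + t)
| exec_if_false s s' e c1 c2 t :
    ~~ is_node (eval s e) -> exec c2 s s' t ->
    exec (If e c1 c2) s s' ((ecost e).+1 + t)
| exec_while_false s e c :
    ~~ is_node (eval s e) -> exec (While e c) s s (ecost e).+1
| exec_while_true s1 s2 s3 e c t1 t2 :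
    is_node (eval s1 e) -> exec c s1 s2 t1 -> exec (While e c) s2 s3 t2 ->
    exec (While e c) s1 s3 ((ecost e).+1 + t1 + t2).

(* Variable 0 holds the input at the start and the output at the end. *)
Definition computes (p : cmd) (inp out : tree) (t : nat) : Prop :=
  exists2 s', exec p (update (fun _ => Leaf) 0 inp) s' t & s' 0 = out.

(* Numbers are written in unary.  Running times are not measured in the length
   of the input, and the values that matter (indices, and capacities up to the
   number of vertices) are bounded by the parameters that do occur in the
   running times, so unary and binary notation are interchangeable here. *)
Definition enc_nat (k : nat) : tree := iter k (Node Leaf) Leaf.
Definition enc_bool (b : bool) : tree := if b then Node Leaf Leaf else Leaf.
Definition enc_seq (T : Type) (enc : T -> tree) (s : seq T) : tree :=
  foldr (fun x t => Node (enc x) t) Leaf s.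

Definition little_o (f g : nat -> nat) : Prop :=
  forall k : nat, exists N : nat, forall x : nat, N <= x -> k * f x <= g x.

(* The literal (b, i) is true when variable i has value b. *)
Definition literal (n : nat) : Type := (bool * 'I_n)%type.
Definition clause (n : nat) : Type := 3.-tuple (literal n).
Definition cnf3 (n : nat) : Type := seq (clause n).

Definition satisfies (n : nat) (a : {ffun 'I_n -> bool}) (phi : cnf3 n) : bool :=
  all (fun c : clause n => has (fun l : literal n => a l.2 == l.1) c) phi.

Definition satisfiable (n : nat) (phi : cnf3 n) : bool :=
  [exists a : {ffun 'I_n -> bool}, satisfies a phi].

Definition enc_literal (n : nat) (l : literal n) : tree :=
  Node (enc_bool l.1) (enc_nat l.2).

Definition enc_cnf3 (n : nat) (phi : cnf3 n) : tree :=
  Node (enc_nat n) (enc_seq (fun c : clause n => enc_seq (@enc_literal n) c) phi).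

Definition solves_3SAT (p : cmd) (T : nat -> nat -> nat) : Prop :=
  forall (n : nat) (phi : cnf3 n),
    exists2 t, computes p (enc_cnf3 phi) (enc_bool (satisfiable phi)) t
             & t <= T n (size phi).

Definition ETH : Prop :=
  ~ exists (p : cmd) (f : nat -> nat),
      little_o f id /\ solves_3SAT p (fun n m => 2 ^ f (n + m)).

Record graph : Type := Graph {
  nverts : nat;
  adj : rel 'I_nverts;
  adj_sym : symmetric adj;
  adj_irrefl : irreflexive adj
}.
Arguments adj : clear implicits.

Definition vertex_cover (G : graph) (A : {set 'I_(nverts G)}) : bool :=
  [forall x, forall y, adj G x y ==> (x \in A) || (y \in A)].
Arguments vertex_cover : clear implicits.

Definition vc (G : graph) : nat :=
  #|[arg min_(A < [set: 'I_(nverts G)] | vertex_cover G A) #|A|]|.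

Definition edges (G : graph) : {set {set 'I_(nverts G)}} :=
  [set [set x; y] | x in 'I_(nverts G), y in 'I_(nverts G) & adj G x y].

Definition induced_edges (G : graph) (B : {set 'I_(nverts G)}) :
    {set {set 'I_(nverts G)}} :=
  [set f in edges G | f \subset B].
Arguments induced_edges : clear implicits.

Definition cap_partition (G : graph) (C : nat)
    (P : {set {set 'I_(nverts G)}}) : bool :=
  partition P [set: 'I_(nverts G)] && [forall B in P, #|B| <= C].
Arguments cap_partition : clear implicits.

Definition value (G : graph) (P : {set {set 'I_(nverts G)}}) : nat :=
  \sum_(B in P) #|induced_edges G B|.
Arguments value : clear implicits.

Definition optimal_partition (G : graph) (C : nat)
    (P : {set {set 'I_(nverts G)}}) : Prop :=
  cap_partition G C P /\ forall Q, cap_partition G C Q -> value G Q <= value G P.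
Arguments optimal_partition : clear implicits.

(* Adjacency matrix, followed by the capacity. *)
Definition enc_instance (G : graph) (C : nat) : tree :=
  Node (enc_seq (fun x => enc_seq (fun y => enc_bool (adj G x y))
                                  (enum 'I_(nverts G)))
                (enum 'I_(nverts G)))
       (enc_nat C).

(* A partition is written as the list of its blocks, each block as the list of
   its elements, without repetitions but in any nverts. *)
Definition represents (n : nat) (out : tree) (P : {set {set 'I_n}}) : Prop :=
  exists s : seq (seq 'I_n),
    [/\ out = enc_seq (fun b => enc_seq (fun x : 'I_n => enc_nat x) b) s,
        uniq (flatten s),
        [::] \notin s
      & P = [set:: [seq [set:: b] | b <- s]]].

(* Capacity 0 is excluded: a nonempty vertex set then has no admissible
   partition. *)
Definition solves_coalition (p : cmd) (T : graph -> nat -> nat) : Prop :=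
  forall (G : graph) (C : nat), 0 < C ->
    exists out t, [/\ computes p (enc_instance G C) out t,
                      t <= T G C
                    & exists2 P : {set {set 'I_(nverts G)}},
                        optimal_partition G C P & represents out P].

(* maxn 2 and .+2 keep the bound meaningful on edgeless, tiny or empty graphs,
   where C * vc or n itself is 0 or 1 and the literal formula would allow no
   time at all.  They also absorb constant factors. *)
Definition coalition_time (f : nat -> nat) (d : nat) (G : graph) (C : nat) : nat :=
  maxn 2 (C * vc G) ^ f (vc G + C) * (nverts G).+2 ^ d.

(* Main.v *)
Require Import Defs.
From HB Require Import structures.
From mathcomp Require Import all_boot.
From mathcomp Require Import zify.

Set Implicit Arguments.
Unset Strict Implicit.
Unset Printing Implicit Defensive.

(** Reduce a 3-CNF with m clauses to a coalition instance with
    [vc + C = O(m / log m)].  Replace every literal occurrence by two fresh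
    copies of its variable, chained by equality constraints, so that a copy lies
    in at most five constraints.  Put [g ~ (log m) / 3] copies into a group and
    [q = 2 ^ g] groups into a block; a block has [q] anchor vertices, one for each
    assignment of a group.  A group vertex in the coalition of the anchor [a]
    means that the group is assigned [a].  Groups and anchors form a vertex cover
    of size [O(m / g)]; the remaining vertices are independent:
    - [L] pendant vertices per anchor, so many that no two anchors can share a
      coalition without loss;
    - [W] common neighbours for each group and anchor of the same block, which
      pay for a group sitting with an anchor of its own block;
    - one vertex per constraint, adjacent to the groups of its literals and to
      the anchors satisfying one of them; it can gain at most 2, and gains 2
      exactly when it joins a coalition in which one of its literals is true.
    The literals of a constraint lie in different blocks, so a coalition with one
    anchor holds at most one of its groups.  Blocks are small enough that all
    constraint vertices of a block fit into one coalition with [C = O(g q)].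
    An algorithm running in time [(C vc)^o(vc + C) n^O(1)] would then decide
    3-SAT in time [2^o(m)] times a polynomial. *)

(** * WHILE programs and polynomial-time functions on trees *)

(** Grouping is forced by the base of the running time. With one vertex per copy, [C * vc] would be
    at least of order [m], and an exponent [o(m)] over that base gives only [2 ^ o(m log m)]. With
    groups, [C * vc] is polynomial in [q], so the base costs a factor [O(g)] in the exponent, and
    this is the factor that grouping saves: [g * (vc + C) = O(m)]. The capacity contributes
    [g ^ 2 * q] to this sum, which is linear in [m] because [g <= q] and [q ^ 3 <= 8 + m]; hence a
    third of the logarithm. The reduction has to be an actual WHILE program with a time bound. It is
    therefore written in a term language in which every term is polynomial by construction, so that
    only the values of the terms remain to be proved. A final program recomputes the value of the
    returned partition and compares it with a target that the reduction has computed as well. Since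
    [little_o] does not make [f] monotone, the exponent of the resulting 3-SAT algorithm is a
    maximum over all parameter values that can occur. *)

Fixpoint emaxvar (e : expr) : nat :=
  match e with
  | EVar x => x
  | ELeaf => 0
  | ENode e1 e2 => maxn (emaxvar e1) (emaxvar e2)
  | EHd e1 | ETl e1 => emaxvar e1
  end.

Fixpoint maxvar (c : cmd) : nat :=
  match c with
  | Skip => 0
  | Assign x e => maxn x (emaxvar e)
  | Seq c1 c2 => maxn (maxvar c1) (maxvar c2)
  | If e c1 c2 => maxn (emaxvar e) (maxn (maxvar c1) (maxvar c2))
  | While e c1 => maxn (emaxvar e) (maxvar c1)
  end.

(** Lets a surrounding program keep its own values in variables above [maxvar]. *)
Lemma exec_frame c s s' t :
  exec c s s' t -> forall x, maxvar c < x -> s' x = s x.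
Proof.
elim=> //=.
- by move=> {}s y e x; rewrite gtn_max /update => /andP[yx _]; case: eqP yx => // ->; rewrite ltnn.
- by move=> s1 s2 s3 c1 c2 t1 t2 _ IH1 _ IH2 x; rewrite gtn_max => /andP[x1 x2]; rewrite IH2 ?IH1.
- by move=> s1 s2 e c1 c2 t1 _ _ IH x; rewrite !gtn_max => /and3P[_ x1 _]; apply: IH.
- by move=> s1 s2 e c1 c2 t1 _ _ IH x; rewrite !gtn_max => /and3P[_ _ x1]; apply: IH.
- move=> s1 s2 s3 e c1 t1 t2 _ _ IH1 _ IH2 x xx; rewrite IH2 // IH1 //.
  by move: xx; rewrite gtn_max => /andP[].
Qed.

Lemma eval_agree e s1 s2 k :
  emaxvar e <= k -> (forall x, x <= k -> s1 x = s2 x) -> eval s1 e = eval s2 e.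
Proof.
move=> + s12; elim: e => //= [e1 IH1 e2 IH2|e IH|e IH].
- by rewrite geq_max => /andP[/IH1-> /IH2->].
- by move/IH->.
- by move/IH->.
Qed.

(** [computes] speaks of a single initial store. This transfers such a run to a store that differs
    only above the variables of the program, as happens when the coalition algorithm is started
    inside a larger program. *)
Lemma exec_agree c s1 s1' t k :
  exec c s1 s1' t -> maxvar c <= k ->
  forall s2, (forall x, x <= k -> s1 x = s2 x) ->
  exists2 s2', exec c s2 s2' t & forall x, x <= k -> s1' x = s2' x.
Proof.
elim=> /=.
- by move=> s _ s2 s12; exists s2 => //; constructor.
- move=> s x e; rewrite geq_max => /andP[xk ek] s2 s12.
  exists (update s2 x (eval s2 e)); first by constructor.
  by move=> y yk; rewrite /update (eval_agree ek s12); case: ifP => // _; apply: s12.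
- move=> a1 a2 a3 c1 c2 t1 t2 _ IH1 _ IH2; rewrite geq_max => /andP[k1 k2] s2 s12.
  have [b2 e1 ab2] := IH1 k1 _ s12; have [b3 e2 ab3] := IH2 k2 _ ab2.
  by exists b3 => //; apply: exec_seq e1 e2.
- move=> a a' e c1 c2 t1 ne _ IH; rewrite !geq_max => /and3P[ek k1 k2] s2 s12.
  have [b' e1 ab] := IH k1 _ s12; exists b' => //.
  by apply: exec_if_true e1; rewrite -(eval_agree ek s12).
- move=> a a' e c1 c2 t1 ne _ IH; rewrite !geq_max => /and3P[ek k1 k2] s2 s12.
  have [b' e1 ab] := IH k2 _ s12; exists b' => //.
  by apply: exec_if_false e1; rewrite -(eval_agree ek s12).
- move=> a e c1 ne; rewrite geq_max => /andP[ek k1] s2 s12.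
  by exists s2 => //; apply: exec_while_false; rewrite -(eval_agree ek s12).
- move=> a1 a2 a3 e c1 t1 t2 ne _ IH1 _ IH2 kk s2 s12.
  have /andP[ek k1] : (emaxvar e <= k) && (maxvar c1 <= k) by rewrite -geq_max.
  have [b2 e1 ab2] := IH1 k1 _ s12; have [b3 e2 ab3] := IH2 kk _ ab2.
  by exists b3 => //; apply: exec_while_true e1 e2; rewrite -(eval_agree ek s12).
Qed.

(** * Total correctness with time bounds *)

Definition hoare (c : cmd) (s : store) (Q : store -> Prop) (n : nat) : Prop :=
  exists s' t, [/\ exec c s s' t, Q s' & t <= n].

Lemma hoare_skip s (Q : store -> Prop) n : Q s -> 0 < n -> hoare Skip s Q n.
Proof. by move=> Qs n0; exists s, 1; split=> //; constructor. Qed.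

Lemma hoare_assign s x e (Q : store -> Prop) n :
  Q (update s x (eval s e)) -> ecost e < n -> hoare (Assign x e) s Q n.
Proof. by move=> Qs en; exists (update s x (eval s e)), (ecost e).+1; split=> //; constructor. Qed.

Lemma hoare_seq c1 c2 s Q1 Q2 n1 n2 n :
  hoare c1 s Q1 n1 -> (forall s1, Q1 s1 -> hoare c2 s1 Q2 n2) -> n1 + n2 <= n ->
  hoare (Seq c1 c2) s Q2 n.
Proof.
move=> [s1 [t1 [e1 q1 l1]]] /(_ _ q1) [s2 [t2 [e2 q2 l2]]] ln.
exists s2, (t1 + t2); split=> //; first exact: exec_seq e1 e2.
exact: leq_trans (leq_add l1 l2) ln.
Qed.

Lemma hoare_if e c1 c2 s Q n m :
  (if is_node (eval s e) then hoare c1 s Q m else hoare c2 s Q m) ->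
  (ecost e).+1 + m <= n -> hoare (If e c1 c2) s Q n.
Proof.
case: ifPn => ne [s' [t [ex q l]]] ln; exists s', ((ecost e).+1 + t); split=> //;
  try (by apply: leq_trans ln; rewrite leq_add2l).
- exact: exec_if_true.
- exact: exec_if_false.
Qed.

Lemma hoare_while_false e c s (Q : store -> Prop) n :
  ~~ is_node (eval s e) -> Q s -> ecost e < n -> hoare (While e c) s Q n.
Proof. by move=> ne qs en; exists s, (ecost e).+1; split=> //; apply: exec_while_false. Qed.

Lemma hoare_while_true e c s Q1 Q2 n1 n2 n :
  is_node (eval s e) -> hoare c s Q1 n1 ->
  (forall s1, Q1 s1 -> hoare (While e c) s1 Q2 n2) ->
  (ecost e).+1 + n1 + n2 <= n -> hoare (While e c) s Q2 n.
Proof.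
move=> ne [s1 [t1 [e1 q1 l1]]] /(_ _ q1) [s2 [t2 [e2 q2 l2]]] ln.
exists s2, ((ecost e).+1 + t1 + t2); split=> //; first exact: exec_while_true e1 e2.
by apply: leq_trans ln; rewrite leq_add // leq_add.
Qed.

Lemma hoare_weaken c s (Q Q' : store -> Prop) n n' :
  hoare c s Q n -> (forall s', Q s' -> Q' s') -> n <= n' -> hoare c s Q' n'.
Proof.
move=> [s' [t [e q l]]] qq nn; exists s', t; split=> //; first exact: qq.
exact: leq_trans nn.
Qed.

(** Unlike in [computes], the other variables are arbitrary at the start, so such programs compose
    without clearing their scratch variables. *)
Definition runs (p : cmd) (v w : tree) (n : nat) : Prop :=
  forall s, s 0 = v -> hoare p s (fun s' => s' 0 = w) n.

Lemma runs_hoare p v w n k s :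
  runs p v w n -> s 0 = v -> maxvar p <= k ->
  hoare p s (fun s' => s' 0 = w /\ forall x, k < x -> s' x = s x) n.
Proof.
move=> r sv pk; have [s' [t [e q l]]] := r s sv; exists s', t; split=> //; split=> // x kx.
by apply: (exec_frame e); apply: leq_ltn_trans kx.
Qed.

Fixpoint teq (a b : tree) : bool :=
  match a, b with
  | Leaf, Leaf => true
  | Node a1 a2, Node b1 b2 => teq a1 b1 && teq a2 b2
  | _, _ => false
  end.

Lemma teqP a b : reflect (a = b) (teq a b).
Proof.
elim: a b => [|a1 IH1 a2 IH2] [|b1 b2] /=; try by constructor.
by apply: (iffP andP) => [[/IH1-> /IH2->]|[/IH1 ? /IH2 ?]].
Qed.
HB.instance Definition _ := hasDecEq.Build tree teqP.

Fixpoint tree_size (v : tree) : nat := if v is Node a b then (tree_size a + tree_size b).+1 else 1.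

Lemma tree_size_gt0 v : 0 < tree_size v. Proof. by case: v. Qed.

Fixpoint tolist (v : tree) : seq tree := if v is Node a b then a :: tolist b else [::].
Definition unlist (s : seq tree) : tree := foldr Node Leaf s.

Lemma tolistK : cancel tolist unlist. Proof. by elim=> //= a _ b ->. Qed.
Lemma unlistK : cancel unlist tolist. Proof. by elim=> //= a s ->. Qed.

(** The size of the result needs its own bound: assigning [Node x x] to [x] doubles a tree at
    constant cost, so the running time does not control it. The base is at least 2, which lets
    constants and sums be absorbed by the exponent. *)
Definition polyf (F : tree -> tree) : Prop :=
  exists p d, forall v,
    runs p v (F v) ((tree_size v).+1 ^ d) /\ tree_size (F v) <= (tree_size v).+1 ^ d.

Lemma leq_polyD a b x d e : a <= x.+2 ^ d -> b <= x.+2 ^ e -> a + b <= x.+2 ^ (d + e).+1.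
Proof.
move=> la lb; have p1 : 0 < x.+2 ^ d by rewrite expn_gt0.
have p2 : 0 < x.+2 ^ e by rewrite expn_gt0.
apply: leq_trans (leq_add la lb) _; rewrite expnS expnD.
by nia.
Qed.

Lemma leq_polyM a b x d e : a <= x.+2 ^ d -> b <= x.+2 ^ e -> a * b <= x.+2 ^ (d + e).
Proof. by move=> la lb; rewrite expnD leq_mul. Qed.

Lemma leq_polyW a x d e : a <= x.+2 ^ d -> d <= e -> a <= x.+2 ^ e.
Proof. by move=> la de; apply: leq_trans la _; rewrite leq_exp2l. Qed.

Lemma leq_polyC a x : a <= x.+2 ^ a.
Proof. by apply: ltnW; apply: ltn_expl. Qed.

Lemma leq_polyX x d : 0 < d -> x.+2 <= x.+2 ^ d.
Proof. by move=> d0; rewrite -{1}(expn1 x.+2) leq_exp2l. Qed.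

Lemma tree_sizeS v : exists x, (tree_size v).+1 = x.+2.
Proof. by exists (tree_size v).-1; rewrite prednK ?tree_size_gt0. Qed.

Lemma polyf_expr e (F : tree -> tree) d :
  (forall s v, s 0 = v -> eval s e = F v) -> (forall v, tree_size (F v) <= (tree_size v).+1 ^ d) ->
  polyf F.
Proof.
move=> eF dF; exists (Assign 0 e), (d + (ecost e).+1) => v; have [x ex] := tree_sizeS v.
rewrite ex; split; last by apply: leq_polyW (leq_addr _ _); rewrite -ex.
move=> s sv; apply: hoare_assign; first by rewrite /update /= (eF _ _ sv).
by apply: leq_polyW (leq_addl _ _); apply: leq_polyC.
Qed.

Lemma polyf_comp F G : polyf F -> polyf G -> polyf (G \o F).
Proof.
move=> [p [d pF]] [q [e qG]].
have key v : (tree_size (F v)).+1 ^ e <= (tree_size v).+1 ^ (d.+1 * e).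
  have [->|e0] := posnP e; first by rewrite muln0.
  rewrite expnM leq_exp2r //.
  have [_ sF] := pF v; have [x ex] := tree_sizeS v; rewrite ex in sF *.
  rewrite -addn1; apply: leq_trans (leq_polyD sF (leqnn (x.+2 ^ 0))) _.
  by rewrite addn0.
exists (Seq p q), (d + d.+1 * e).+1 => v.
have [rF sF] := pF v; have [rG sG] := qG (F v).
have [x ex] := tree_sizeS v; have := key v; rewrite ex in rF sF * => kk.
split.
- move=> s sv; apply: hoare_seq (rF s sv) _ (leq_polyD (leqnn _) kk) => s1 s1F.
  exact: rG.
- apply: leq_trans sG (leq_trans kk _).
  by rewrite leq_exp2l // leqW // leq_addl.
Qed.

Lemma eq_polyf F G : F =1 G -> polyf F -> polyf G.
Proof. by move=> FG [p [d pF]]; exists p, d => v; rewrite -FG; apply: pF. Qed.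

Lemma updE s x v : update s x v x = v. Proof. by rewrite /update eqxx. Qed.
Lemma updN s x v y : y != x -> update s x v y = s y.
Proof. by rewrite /update => /negPf->. Qed.

Lemma polyf_node F G : polyf F -> polyf G -> polyf (fun v => Node (F v) (G v)).
Proof.
move=> [p [d pF]] [q [e qG]]; set M := maxn (maxvar p) (maxvar q).
have pM : maxvar p <= M by apply: leq_maxl.
have qM : maxvar q <= M by apply: leq_maxr.
(* [M.+1] keeps the input for the second run, [M.+2] the first result. *)
exists (Seq (Assign M.+1 (EVar 0)) (Seq p (Seq (Assign M.+2 (EVar 0))
  (Seq (Assign 0 (EVar M.+1)) (Seq q (Assign 0 (ENode (EVar M.+2) (EVar 0)))))))).
exists ((d + e).+1 + 10).+1 => v.
have [rF sF] := pF v; have [rG sG] := qG v; have [x ex] := tree_sizeS v.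
rewrite ex in rF sF rG sG *.
have sum := leq_polyD sF sG; split; last first.
  by rewrite /= -addn1; apply: leq_polyD => //; rewrite -(exp1n 10) leq_exp2r.
move=> s sv.
apply: (hoare_seq (n1 := 2) (n2 := x.+2 ^ d + (x.+2 ^ e + 8))
  (Q1 := fun s1 => s1 0 = v /\ s1 M.+1 = v)).
- by apply: hoare_assign => //; rewrite updE updN.
- move=> s1 [s10 s1M]; apply: hoare_seq (runs_hoare rF s10 pM) _ (leqnn _).
  move=> s2 [s20 s2f].
  apply: (hoare_seq (n1 := 2) (n2 := x.+2 ^ e + 6)
    (Q1 := fun s3 => s3 M.+1 = v /\ s3 M.+2 = F v)).
  + apply: hoare_assign => //; rewrite updE updN; last by apply/eqP; lia.
    by rewrite s2f.
  + move=> s3 [s3M s3M2].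
    apply: (hoare_seq (n1 := 2) (n2 := x.+2 ^ e + 4)
      (Q1 := fun s3 => s3 0 = v /\ s3 M.+2 = F v)).
    * by apply: hoare_assign => //; rewrite updE updN ?s3M.
    * move=> s4 [s40 s4M2].
      apply: hoare_seq (runs_hoare rG s40 qM) _ (leqnn _) => s5 [s50 s5f].
      by apply: hoare_assign => //=; rewrite updE s50 s5f // s4M2.
    * by rewrite addnC -addnA leq_add2l.
  + lia.
- apply: leq_trans (leq_polyD (leq_polyD (leqnn (x.+2 ^ d)) (leqnn (x.+2 ^ e))) (leq_polyC 10 x)).
  lia.
Qed.

Lemma polyf_if F G H : polyf F -> polyf G -> polyf H ->
  polyf (fun v => if is_node (F v) then G v else H v).
Proof.
move=> [p [d pF]] [q [e qG]] [r [f rH]].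
set M := maxn (maxvar p) (maxn (maxvar q) (maxvar r)).
have pM : maxvar p <= M by apply: leq_maxl.
exists (Seq (Assign M.+1 (EVar 0)) (Seq p (If (EVar 0)
  (Seq (Assign 0 (EVar M.+1)) q) (Seq (Assign 0 (EVar M.+1)) r)))).
exists ((d + (e + f).+1).+1 + 10).+1 => v.
have [rF sF] := pF v; have [rG sG] := qG v; have [rH' sH] := rH v; have [x ex] := tree_sizeS v.
rewrite ex in rF sF rG sG rH' sH *; split; last first.
  by case: ifP => _; [apply: leq_polyW sG _|apply: leq_polyW sH _]; lia.
move=> s sv.
apply: (hoare_seq (n1 := 2) (n2 := x.+2 ^ d + (x.+2 ^ e + x.+2 ^ f + 4))
  (Q1 := fun s1 => s1 0 = v /\ s1 M.+1 = v)).
- by apply: hoare_assign => //; rewrite updE updN.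
- move=> s1 [s10 s1M]; apply: hoare_seq (runs_hoare rF s10 pM) _ (leqnn _).
  move=> s2 [s20 s2f]; have s2M : s2 M.+1 = v by rewrite s2f.
  apply: (hoare_if (m := x.+2 ^ e + x.+2 ^ f + 2)); last by rewrite /=; lia.
  rewrite /= s20; case: (is_node (F v)).
  + apply: (hoare_seq (n1 := 2) (n2 := x.+2 ^ e) (Q1 := fun s3 => s3 0 = v)); last by lia.
      by apply: hoare_assign => //; rewrite updE.
    by move=> s3 s30; apply: rG.
  + apply: (hoare_seq (n1 := 2) (n2 := x.+2 ^ f) (Q1 := fun s3 => s3 0 = v)); last by lia.
      by apply: hoare_assign => //; rewrite updE.
    by move=> s3 s30; apply: rH'.
- apply: leq_trans (leq_polyD (leq_polyD (leqnn (x.+2 ^ d))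
    (leq_polyD (leqnn (x.+2 ^ e)) (leqnn (x.+2 ^ f)))) (leq_polyC 10 x)).
  lia.
Qed.

Lemma size_tolist v : size (tolist v) <= (tree_size v).-1.
Proof. by elim: v => //= a _ b IH; have := tree_size_gt0 b; lia. Qed.

Lemma tree_size_unlist s : tree_size (unlist s) = (\sum_(x <- s) (tree_size x).+1).+1.
Proof. by elim: s => [|x s IH] /=; rewrite ?big_nil // big_cons IH; lia. Qed.

Definition revmove (a b : nat) : cmd :=
  While (EVar a) (Seq (Assign b (ENode (EHd (EVar a)) (EVar b))) (Assign a (ETl (EVar a)))).

Lemma hoare_revmove a b s : a != b ->
  hoare (revmove a b) s
    (fun s' => s' b = unlist (catrev (tolist (s a)) (tolist (s b))) /\
               forall x, x != a -> x != b -> s' x = s x)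
    (10 * size (tolist (s a)) + 2).
Proof.
move=> ab; have [n le_n] := ubnP (size (tolist (s a))).
elim: n s le_n => // n IH s le_n; case sa: (s a) => [|h t] /=.
  by apply: hoare_while_false => //=; rewrite ?sa //= tolistK.
apply: (hoare_while_true (n1 := 8) (n2 := 10 * size (tolist t) + 2)
  (Q1 := fun s1 => [/\ s1 a = t, s1 b = Node h (s b) & forall x, x != a -> x != b -> s1 x = s x])).
- by rewrite /= sa.
- apply: (hoare_seq (n1 := 5) (n2 := 3) (Q1 := fun s1 => [/\ s1 a = s a, s1 b = Node h (s b) &
    forall x, x != a -> x != b -> s1 x = s x])) => //.
    apply: hoare_assign => //=; rewrite sa /= updE updN //; split=> // x _ xb.
    by rewrite updN.
  move=> s1 [s1a s1b s1x]; apply: hoare_assign => //=.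
  rewrite updE updN 1?eq_sym // s1a sa s1b; split=> // x xa xb.
  by rewrite updN // s1x.
- move=> s1 [s1a s1b s1x]; have := IH s1; rewrite s1a s1b.
  move: le_n; rewrite sa /= => le_n /(_ le_n) ih.
  apply: hoare_weaken ih _ (leqnn _) => s2 [-> s2x]; split=> // x xa xb.
  by rewrite s2x ?s1x.
- by rewrite /=; lia.
Qed.

(** The body sees the current element in front of the environment [tl v], which is the de Bruijn
    convention of [TFor]. *)
Definition flatmap (F : tree -> tree) (v : tree) : tree :=
  unlist (flatten [seq tolist (F (Node x (tl v))) | x <- tolist (hd v)]).

Lemma tree_size_flatten B (s : seq (seq tree)) :
  (forall l, l \in s -> tree_size (unlist l) <= B) ->
  tree_size (unlist (flatten s)) <= (size s * B).+1.
Proof.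
elim: s => //= l s IH sB.
have h1 := sB _ (mem_head _ _).
have h2 : tree_size (unlist (flatten s)) <= (size s * B).+1.
  by apply: IH => l' l's; apply: sB; rewrite inE l's orbT.
move: h1 h2; rewrite !tree_size_unlist big_cat /=; lia.
Qed.

Lemma mem_tolist x v : x \in tolist v -> tree_size x < tree_size v.
Proof.
elim: v => //= a _ b IH; rewrite inE => /orP[/eqP->|/IH]; have := tree_size_gt0 b; lia.
Qed.

Lemma polyf_flatmap F : polyf F -> polyf (flatmap F).
Proof.
move=> [p [d pF]]; set M := maxvar p.
(* [M.+1] holds the elements still to be treated, [M.+2] the environment, and [M.+3] the output in
   reverse, which the last [revmove] turns round. *)
pose body := Seq (Assign 0 (ENode (EHd (EVar M.+1)) (EVar M.+2)))
  (Seq p (Seq (revmove 0 M.+3) (Assign M.+1 (ETl (EVar M.+1))))).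
pose loop := While (EVar M.+1) body.
exists (Seq (Assign M.+1 (EHd (EVar 0))) (Seq (Assign M.+2 (ETl (EVar 0)))
  (Seq (Assign M.+3 ELeaf) (Seq loop (Seq (Assign 0 ELeaf) (revmove M.+3 0)))))).
exists (d + 7) => v; have [x ex] := tree_sizeS v.
set B := (tree_size v).+1 ^ d.
have B0 : 0 < B by rewrite expn_gt0.
(* [Node y (tl v)] is no larger than [v], so one bound [B] serves all rounds. *)
have FB y : y \in tolist (hd v) ->
    runs p (Node y (tl v)) (F (Node y (tl v))) B /\ tree_size (F (Node y (tl v))) <= B.
  move=> yl; have le : (tree_size (Node y (tl v))).+1 <= (tree_size v).+1.
    by case: v {ex B B0} yl => //= a b /mem_tolist; lia.
  have [r1 r2] := pF (Node y (tl v)).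
  have leB : (tree_size (Node y (tl v))).+1 ^ d <= B.
    by rewrite /B; case: (posnP d) => [->|d0] //; rewrite leq_exp2r.
  split; last exact: leq_trans leB.
  by move=> s sv; apply: hoare_weaken (r1 s sv) _ leB.
set out := fun l => flatten [seq tolist (F (Node x (tl v))) | x <- l].
have szout l : {subset l <= tolist (hd v)} -> size (out l) <= size l * B.
  elim: l => //= y l IH sub; rewrite size_cat mulSn leq_add //.
    have [_] := FB y (sub _ (mem_head _ _)); have := size_tolist (F (Node y (tl v))); lia.
  by apply: IH => z zl; apply: sub; rewrite inE zl orbT.
have loopP l acc s : {subset l <= tolist (hd v)} ->
    s M.+1 = unlist l -> s M.+2 = tl v -> s M.+3 = unlist acc ->
    hoare loop s (fun s' => s' M.+3 = unlist (catrev (out l) acc))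
      (size l * (12 + 11 * B) + 2).
  elim: l acc s => [|y l IH] acc s sub s1 s2 s3.
    by apply: hoare_while_false => //=; rewrite s1.
  have [r1 r2] := FB y (sub _ (mem_head _ _)).
  set r := F (Node y (tl v)) in r1 r2.
  apply: (hoare_while_true (n1 := 10 + 11 * B) (n2 := size l * (12 + 11 * B) + 2)
    (Q1 := fun s' => [/\ s' M.+1 = unlist l, s' M.+2 = tl v &
       s' M.+3 = unlist (catrev (tolist r) acc)])).
  - by rewrite /= s1.
  - apply: (hoare_seq (n1 := 5) (n2 := 5 + 11 * B) (Q1 := fun s' => [/\ s' 0 = Node y (tl v),
      s' M.+1 = unlist (y :: l), s' M.+2 = tl v & s' M.+3 = unlist acc])); last by lia.
      by apply: hoare_assign => //=; rewrite updE !updN // s1 s2 s3.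
    move=> t0 [t00 t01 t02 t03].
    apply: (hoare_seq (n2 := 5 + 10 * B) (runs_hoare r1 t00 (leqnn _))); last by lia.
    move=> t1 [t10 t1f].
    apply: (hoare_seq (n2 := 3) (hoare_revmove t1 (isT : 0 != M.+3))) => [t2 [t23 t2f]|].
      apply: hoare_assign => //=.
      have n12 : M.+2 != M.+1 by apply/eqP; lia.
      have n13 : M.+3 != M.+1 by apply/eqP; lia.
      have n32 : M.+2 != M.+3 by apply/eqP; lia.
      split; first by rewrite updE t2f ?t1f ?t01 // eq_sym.
        by rewrite updN // t2f // t1f ?t02.
      by rewrite updN // t23 t10 t1f ?t03 ?unlistK // /M; lia.
    by rewrite t10; have := size_tolist r; lia.
  - move=> t [t1 t2 t3].
    apply: hoare_weaken (IH _ _ _ t1 t2 t3) _ (leqnn _).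
      by move=> z zl; apply: sub; rewrite inE zl orbT.
    by move=> t' ->; rewrite /out /= !catrevE rev_cat catA.
  - by rewrite /=; lia.
have lv : size (tolist (hd v)) <= tree_size v.
  by case: (v) => //= a b; have := size_tolist a; lia.
have total n : n <= (tree_size v).+1 * (12 + 21 * B) + 30 -> n <= (tree_size v).+1 ^ (d + 7).
  move=> le; apply: leq_trans le _.
  have -> : d + 7 = 6 + d.+1 by lia.
  rewrite expnD [_ ^ d.+1]expnS -/B.
  have : 2 ^ 6 <= (tree_size v).+1 ^ 6 by rewrite leq_exp2r // ltnS tree_size_gt0.
  have := tree_size_gt0 v; set X := tree_size v; set Y := X.+1 ^ 6 => x0 y64.
  have h1 : X.+1 * (12 + 21 * B) + 30 <= 64 * (X.+1 * B) by nia.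
  by apply: leq_trans h1 _; rewrite leq_mul2r y64 orbT.
split; last first.
  apply: total; rewrite /flatmap.
  apply: leq_trans (tree_size_flatten (B := B) _) _.
    by move=> l /mapP[y yl ->]; rewrite tolistK; apply: (FB y yl).2.
  rewrite size_map; nia.
move=> s sv.
apply: (hoare_weaken (n := 3 + (3 + (2 + ((size (tolist (hd v)) * (12 + 11 * B) + 2) +
  (2 + (10 * (size (tolist (hd v)) * B) + 2))))))); last 2 first.
- by move=> s'; apply: id.
- by apply: total; nia.
apply: (hoare_seq (n1 := 3) (Q1 := fun s' => s' 0 = v /\ s' M.+1 = hd v)) (leqnn _).
  by apply: hoare_assign => //=; rewrite updE updN // sv.
move=> s1 [s10 s11].
apply: (hoare_seq (n1 := 3) (Q1 := fun s' => s' M.+1 = hd v /\ s' M.+2 = tl v)) (leqnn _).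
  by apply: hoare_assign => //=; rewrite updE updN ?s10 //; apply/eqP; lia.
move=> s2 [s21 s22].
apply: (hoare_seq (n1 := 2) (Q1 := fun s' => [/\ s' M.+1 = hd v, s' M.+2 = tl v &
  s' M.+3 = Leaf])) (leqnn _).
  by apply: hoare_assign => //=; rewrite updE !updN //; apply/eqP; lia.
move=> s3 [s31 s32 s33].
apply: hoare_seq (loopP (tolist (hd v)) [::] s3 _ _ s32 s33) _ (leqnn _) => //.
  by rewrite tolistK.
move=> s4 s4M.
apply: (hoare_seq (n1 := 2) (Q1 := fun s' =>
  s' 0 = Leaf /\ s' M.+3 = unlist (rev (out (tolist (hd v)))))) (leqnn _).
  by apply: hoare_assign => //=; rewrite updE updN // s4M catrevE cats0.
move=> s5 [s50 s5M].
apply: hoare_weaken (hoare_revmove s5 (isT : M.+3 != 0)) _ _.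
  by move=> s6 [-> _]; rewrite s5M s50 unlistK catrevE revK cats0.
by rewrite s5M unlistK size_rev leq_add2r leq_mul2l /=; apply: szout.
Qed.

(** The second list acts as a unary number. Dropping serves for indexing, and also for comparison:
    the result is a node exactly when the first list is longer. *)
Definition dropf (v : tree) : tree := iter (size (tolist (tl v))) tl (hd v).

Lemma iter_tl k l : iter k tl l = unlist (drop k (tolist l)).
Proof.
elim: k l => [|k IH] l; first by rewrite drop0 tolistK.
by rewrite iterSr IH; case: l.
Qed.

Lemma tree_size_hd v : tree_size (hd v) <= tree_size v. Proof. by case: v => //= a b; lia. Qed.
Lemma tree_size_tl v : tree_size (tl v) <= tree_size v. Proof. by case: v => //= a b; lia. Qed.
Lemma tree_size_iter_tl k v : tree_size (iter k tl v) <= tree_size v.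
Proof. by elim: k => //= k IH; apply: leq_trans (tree_size_tl _) IH. Qed.

Lemma polyf_drop : polyf dropf.
Proof.
exists (Seq (Assign 1 (ETl (EVar 0))) (Seq (Assign 0 (EHd (EVar 0)))
  (While (EVar 1) (Seq (Assign 0 (ETl (EVar 0))) (Assign 1 (ETl (EVar 1))))))), 5 => v.
have [x ex] := tree_sizeS v; split; last first.
  apply: leq_trans (tree_size_iter_tl _ _) (leq_trans (tree_size_hd _) _).
  by rewrite ex; apply: leq_trans (leq_polyX x (isT : 0 < 5)); lia.
move=> s sv.
apply: (hoare_weaken (n := 3 + (3 + (8 * size (tolist (tl v)) + 2)))
  (Q := fun s' => s' 0 = dropf v)) => //; last first.
  have := size_tolist (tl v); have := tree_size_tl v; rewrite ex => h1 h2.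
  apply: leq_trans (_ : 8 * x.+2 + 8 <= _); first by lia.
  have : 2 ^ 4 <= x.+2 ^ 4 by rewrite leq_exp2r.
  by rewrite expnS; nia.
apply: (hoare_seq (n1 := 3) (Q1 := fun s' => s' 0 = v /\ s' 1 = tl v)) (leqnn _).
  by apply: hoare_assign => //=; rewrite updE updN // sv.
move=> s1 [s10 s11].
apply: (hoare_seq (n1 := 3) (Q1 := fun s' => s' 0 = hd v /\ s' 1 = tl v)) (leqnn _).
  by apply: hoare_assign => //=; rewrite updE updN // s10.
move=> s2 [s20 s21]; rewrite /dropf; move: (hd v) (tl v) s20 s21 => a b.
elim: b a s2 => [|h _ b IH] a s2 s20 s21.
  by apply: hoare_while_false => //=; rewrite s21.
apply: (hoare_while_true (n1 := 6) (n2 := 8 * size (tolist b) + 2)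
  (Q1 := fun s' => s' 0 = tl a /\ s' 1 = b)).
- by rewrite /= s21.
- apply: (hoare_seq (n1 := 3) (n2 := 3) (Q1 := fun s' => s' 0 = tl a /\ s' 1 = Node h b)) => //.
    by apply: hoare_assign => //=; rewrite updE updN // s20.
  by move=> s3 [s30 s31]; apply: hoare_assign => //=; rewrite updE updN // s31.
- by move=> s3 [s30 s31]; rewrite [size _]/= iterSr; apply: IH.
- by rewrite /=; lia.
Qed.

Definition eqf (v : tree) : tree := enc_bool (hd v == tl v).

(** The machine can only test for being a node, so equality is decided with a stack of pairs still
    to be compared. A mismatch clears the flag in variable 2 and the loop goes on. *)
Lemma polyf_eq : polyf eqf.
Proof.
pose body := Seq (Assign 0 (EHd (EVar 1))) (Seq (Assign 1 (ETl (EVar 1)))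
  (If (EHd (EVar 0))
     (If (ETl (EVar 0))
        (Assign 1 (ENode (ENode (EHd (EHd (EVar 0))) (EHd (ETl (EVar 0))))
                  (ENode (ENode (ETl (EHd (EVar 0))) (ETl (ETl (EVar 0)))) (EVar 1))))
        (Assign 2 ELeaf))
     (If (ETl (EVar 0)) (Assign 2 ELeaf) Skip))).
exists (Seq (Assign 1 (ENode (EVar 0) ELeaf)) (Seq (Assign 2 (ENode ELeaf ELeaf))
  (Seq (While (EVar 1) body) (Assign 0 (EVar 2))))), 6 => v.
have [x ex] := tree_sizeS v; split; last first.
  rewrite /eqf; apply: (@leq_trans 3); first by case: (_ == _).
  by rewrite ex; apply: (@leq_trans (2 ^ 6)) => //; rewrite leq_exp2r.
(* Every round lowers this measure: a pair with a leaf leaves the stack, and splitting a node on the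
   left removes one unit. *)
pose meas (st : seq tree) := \sum_(y <- st) tree_size (hd y).
have loopP n st f s : meas st <= n -> s 1 = unlist st -> s 2 = enc_bool f ->
    hoare (While (EVar 1) body) s
      (fun s' => s' 2 = enc_bool (f && all (fun y => hd y == tl y) st)) (32 * n + 2).
  elim: n st f s => [|n IH] [|y st] f s.
  - by move=> _ s1 s2; apply: hoare_while_false => //=; rewrite ?s1 // andbT.
  - by rewrite /meas big_cons; have := tree_size_gt0 (hd y); lia.
  - by move=> _ s1 s2; apply: hoare_while_false => //=; rewrite ?s1 // ?andbT //; lia.
  rewrite {1}/meas big_cons -/(meas st) => le s1 s2.
  have [st' [f' [m' ff']]] : exists st' f', [/\ meas st' <= n,
      (f' && all (fun y => hd y == tl y) st') =
      (f && all (fun y => hd y == tl y) (y :: st)) &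
      hoare body s (fun s' => s' 1 = unlist st' /\ s' 2 = enc_bool f') 30].
    have first_part (Q : store -> Prop) :
      (forall s', s' 0 = y -> s' 1 = unlist st -> s' 2 = enc_bool f ->
         hoare (If (EHd (EVar 0))
     (If (ETl (EVar 0))
        (Assign 1 (ENode (ENode (EHd (EHd (EVar 0))) (EHd (ETl (EVar 0))))
                  (ENode (ENode (ETl (EHd (EVar 0))) (ETl (ETl (EVar 0)))) (EVar 1))))
        (Assign 2 ELeaf))
     (If (ETl (EVar 0)) (Assign 2 ELeaf) Skip)) s' Q 24) -> hoare body s Q 30.
      move=> h.
      apply: (hoare_seq (n1 := 3) (n2 := 27) (Q1 := fun s' => [/\ s' 0 = y,
        s' 1 = unlist (y :: st) & s' 2 = enc_bool f])) => //.
        by apply: hoare_assign => //=; rewrite updE !updN // s1 s2.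
      move=> s3 [s30 s31 s32].
      apply: (hoare_seq (n1 := 3) (n2 := 24) (Q1 := fun s' => [/\ s' 0 = y,
        s' 1 = unlist st & s' 2 = enc_bool f])) => //.
        by apply: hoare_assign => //=; rewrite updE !updN // s31 s30 s32.
      by move=> s4 [? ? ?]; apply: h.
    case E1: (hd y) => [|a1 a2]; case E2: (tl y) => [|b1 b2].
    - exists st, f; split; [move: le; rewrite E1 /=; lia|by rewrite /= E1 E2|].
      apply: first_part => s' s'0 s'1 s'2.
      apply: (hoare_if (m := 5)) => //=; rewrite s'0 E1 /=.
      apply: (hoare_if (m := 2)) => //=; rewrite s'0 E2 /=.
      by apply: hoare_skip.
    - exists st, false; split; [move: le; rewrite E1 /=; lia|by rewrite /= E1 E2 andbF|].
      apply: first_part => s' s'0 s'1 s'2.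
      apply: (hoare_if (m := 5)) => //=; rewrite s'0 E1 /=.
      apply: (hoare_if (m := 2)) => //=; rewrite s'0 E2 /=.
      by apply: hoare_assign.
    - exists st, false; split; [move: le; rewrite E1 /=; lia|by rewrite /= E1 E2 andbF|].
      apply: first_part => s' s'0 s'1 s'2.
      apply: (hoare_if (m := 5)) => //=; rewrite s'0 E1 /=.
      apply: (hoare_if (m := 2)) => //=; rewrite s'0 E2 /=.
      by apply: hoare_assign.
    - exists (Node a1 b1 :: Node a2 b2 :: st), f; split.
      + by move: le; rewrite E1 /meas !big_cons /=; lia.
      + rewrite /= E1 E2.
        have -> : (Node a1 a2 == Node b1 b2) = ((a1 == b1) && (a2 == b2)) by [].
        by rewrite -!andbA.
      + apply: first_part => s' s'0 s'1 s'2.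
        apply: (hoare_if (m := 21)) => //=; rewrite s'0 E1 /=.
        apply: (hoare_if (m := 18)) => //=; rewrite s'0 E2 /=.
        by apply: hoare_assign => //=; rewrite updE updN // s'0 E1 E2 s'1.
  move=> hb; apply: (hoare_while_true (n2 := 32 * n + 2) _ hb).
  - by rewrite /= s1.
  - by move=> s3 [s31 s32]; rewrite -ff'; apply: IH.
  - by rewrite /=; lia.
move=> s sv.
apply: (hoare_weaken (n := 4 + (4 + ((32 * tree_size (hd v) + 2) + 2)))
  (Q := fun s' => s' 0 = eqf v)) => //; last first.
  have := tree_size_hd v; rewrite ex => h1.
  have : 2 ^ 5 <= x.+2 ^ 5 by rewrite leq_exp2r.
  by rewrite expnS; move: ex; nia.
apply: (hoare_seq (n1 := 4) (Q1 := fun s' => s' 1 = Node v Leaf)) (leqnn _).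
  by apply: hoare_assign => //=; rewrite updE sv.
move=> s1 s11.
apply: (hoare_seq (n1 := 4) (Q1 := fun s' => s' 1 = Node v Leaf /\ s' 2 = enc_bool true)) (leqnn _).
  by apply: hoare_assign => //=; rewrite updE updN.
move=> s2 [s21 s22].
apply: (hoare_seq (n2 := 2) (loopP (tree_size (hd v)) [:: v] true s2 _ s21 s22)) (leqnn _).
  by rewrite /meas big_seq1.
move=> s3; rewrite /= andbT => s32.
by apply: hoare_assign => //=; rewrite updE s32.
Qed.

(** Shortest suffix first, the order in which a loop pushing suffixes leaves them; this is why
    clauses are enumerated by [rev (enum 'I_m)]. A suffix gives access to an element, to its
    successor and, through its length, to its position. *)
Fixpoint rsuf (T : Type) (l : seq T) : seq (seq T) :=
  if l is x :: l' then rcons (rsuf l') l else [::].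

Definition tailsf (v : tree) : tree := unlist [seq unlist l | l <- rsuf (tolist v)].

Lemma polyf_tails : polyf tailsf.
Proof.
exists (Seq (Assign 1 ELeaf) (Seq (While (EVar 0)
  (Seq (Assign 1 (ENode (EVar 0) (EVar 1))) (Assign 0 (ETl (EVar 0))))) (Assign 0 (EVar 1)))), 6 => v.
have [x ex] := tree_sizeS v; split; last first.
  have : tree_size (tailsf v) <= tree_size v * tree_size v.
    rewrite /tailsf; elim: (v) => //= a _ b.
    rewrite map_rcons !tree_size_unlist -cats1 big_cat big_seq1 /= tolistK.
    have := tree_size_gt0 a; have := tree_size_gt0 b; nia.
  move=> h; apply: leq_trans h _; rewrite ex.
  apply: leq_trans (_ : x.+2 ^ 2 <= _); last by rewrite leq_exp2l.
  by rewrite expnS expn1; move: ex; nia.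
have loopP w acc s : s 0 = w -> s 1 = acc ->
   hoare (While (EVar 0)
  (Seq (Assign 1 (ENode (EVar 0) (EVar 1))) (Assign 0 (ETl (EVar 0))))) s
     (fun s' => s' 1 = unlist ([seq unlist l | l <- rsuf (tolist w)] ++ tolist acc))
     (9 * size (tolist w) + 2).
  elim: w acc s => [|h _ w IH] acc s s0 s1.
    by apply: hoare_while_false => //=; rewrite ?s0 // s1 tolistK.
  apply: (hoare_while_true (n1 := 7) (n2 := 9 * size (tolist w) + 2)
    (Q1 := fun s' => s' 0 = w /\ s' 1 = Node (Node h w) acc)).
  - by rewrite /= s0.
  - apply: (hoare_seq (n1 := 4) (n2 := 3)
      (Q1 := fun s' => s' 0 = Node h w /\ s' 1 = Node (Node h w) acc)) => //.
      by apply: hoare_assign => //=; rewrite updE updN // s0 s1.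
    by move=> s2 [s20 s21]; apply: hoare_assign => //=; rewrite updE updN // s20.
  - move=> s2 [s20 s21]; apply: hoare_weaken (IH _ _ s20 s21) _ (leqnn _) => s3 ->.
    by rewrite /= map_rcons /= tolistK cat_rcons.
  - by rewrite /=; lia.
move=> s sv.
apply: (hoare_weaken (n := 2 + (9 * size (tolist v) + 2 + 2))
  (Q := fun s' => s' 0 = tailsf v)) => //; last first.
  have := size_tolist v; rewrite ex => h1.
  have : 2 ^ 5 <= x.+2 ^ 5 by rewrite leq_exp2r.
  by rewrite expnS; move: ex; nia.
apply: (hoare_seq (n1 := 2) (Q1 := fun s' => s' 0 = v /\ s' 1 = Leaf)) (leqnn _).
  by apply: hoare_assign => //=; rewrite updE updN.
move=> s1 [s10 s11]; apply: (hoare_seq (n2 := 2) (loopP _ _ _ s10 s11)) (leqnn _) => s2 s21.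
by apply: hoare_assign => //=; rewrite updE s21 /tailsf cats0.
Qed.

(* The head of the state is the list of remaining rounds. *)
Lemma polyf_loop I F d : polyf I -> polyf F -> (forall w, hd (F w) = tl (hd w)) ->
  (forall v i, tree_size (iter i F (I v)) <= (tree_size v).+1 ^ d) ->
  polyf (fun v => iter (size (tolist (hd (I v)))) F (I v)).
Proof.
move=> [p [dp pI]] [q [dq qF]] hF szF.
exists (Seq p (While (EHd (EVar 0)) q)), (dp + (d + (3 + d.+1 * dq).+1 + 3).+1).+1 => v.
have [rI sI] := pI v; have [x ex] := tree_sizeS v.
have {}szF i : tree_size (iter i F (I v)) <= x.+2 ^ d by rewrite -ex.
rewrite ex in rI sI *; split; last by apply: leq_polyW (szF _) _; lia.
have step i : (tree_size (iter i F (I v))).+1 ^ dq <= x.+2 ^ (d.+1 * dq).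
  have [->|q0] := posnP dq; first by rewrite muln0.
  rewrite expnM leq_exp2r //.
  by rewrite -addn1 -[d]addn0; apply: leq_polyD (szF i) _.
set c := x.+2 ^ (d.+1 * dq) in step.
have loopP k i s : s 0 = iter i F (I v) -> size (tolist (hd (s 0))) = k ->
  hoare (While (EHd (EVar 0)) q) s (fun s' => s' 0 = iter (k + i) F (I v)) (k * (3 + c) + 3).
  elim: k i s => [|k IH] i s s0 sk.
    by apply: hoare_while_false => //=; move: sk; case: (hd (s 0)).
  have [rF _] := qF (iter i F (I v)).
  apply: (hoare_while_true (n1 := c) (n2 := k * (3 + c) + 3)
            (Q1 := fun s' => s' 0 = iter i.+1 F (I v))).
  - by rewrite /=; move: sk; case: (hd (s 0)).
  - by apply: hoare_weaken (rF s s0) _ (step i).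
  - move=> s1 s10; rewrite addSnnS; apply: IH => //.
    by rewrite s10 /= hF -s0; move: sk; case: (hd (s 0)) => //= a b [].
  - by rewrite /=; lia.
move=> s sv.
apply: (hoare_seq (n2 := size (tolist (hd (I v))) * (3 + c) + 3) (rI s sv)) => [s1 s10|].
  have sz : size (tolist (hd (s1 0))) = size (tolist (hd (I v))) by rewrite s10.
  by apply: hoare_weaken (loopP _ 0 s1 s10 sz) _ (leqnn _) => s2 ->; rewrite addn0.
apply: leq_polyD (leqnn _) _.
apply: leq_trans (leq_polyD (leq_polyM (leqnn (x.+2 ^ d))
  (leq_polyD (leq_polyC 3 x) (leqnn c))) (leq_polyC 3 x)).
rewrite leq_add2r leq_mul2r; apply/orP; right.
have := size_tolist (hd (I v)); have := tree_size_hd (I v); have := szF 0; rewrite /=; lia.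
Qed.

(* A first-order language all of whose terms are polynomial-time: the only
   iteration is [TFor], which concatenates lists, so sizes stay polynomial.
   Variables are de Bruijn indices into an environment that is itself a tree;
   [TCall f a] runs [f] in the environment [a]. *)
Inductive term : Type :=
| TVar of nat
| TLeaf
| TNode of term & term
| THd of term
| TTl of term
| TIf of term & term & term
| TFor of term & term
| TDrop of term & term
| TEq of term & term
| TTails of term
| TCall of term & term.

Fixpoint den (e : term) (v : tree) : tree :=
  match e with
  | TVar n => hd (iter n tl v)
  | TLeaf => Leaf
  | TNode a b => Node (den a v) (den b v)
  | THd a => hd (den a v)
  | TTl a => tl (den a v)
  | TIf c a b => if is_node (den c v) then den a v else den b v
  | TFor a b => flatmap (den b) (Node (den a v) v)
  | TDrop a b => dropf (Node (den a v) (den b v))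
  | TEq a b => eqf (Node (den a v) (den b v))
  | TTails a => tailsf (den a v)
  | TCall f a => den f (den a v)
  end.

Lemma polyf_id : polyf id.
Proof.
apply: (@polyf_expr (EVar 0) _ 1) => // v; rewrite expn1; exact: leqnSn.
Qed.

Lemma polyf_den e : polyf (den e).
Proof.
elim: e => /=.
- move=> n; apply: (@polyf_expr (EHd (iter n ETl (EVar 0))) _ 1) => [s v sv|v] /=.
    by congr hd; elim: n => //= n ->.
  rewrite expn1; apply: leqW; exact: leq_trans (tree_size_hd _) (tree_size_iter_tl _ _).
- by apply: (@polyf_expr ELeaf _ 0).
- by move=> a pa b pb; apply: polyf_node.
- move=> a pa; apply: eq_polyf (polyf_comp pa _) => [v //=|].
  by apply: (@polyf_expr (EHd (EVar 0)) _ 1) => [s v <-|v] //; rewrite expn1; apply/leqW/tree_size_hd.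
- move=> a pa; apply: eq_polyf (polyf_comp pa _) => [v //=|].
  by apply: (@polyf_expr (ETl (EVar 0)) _ 1) => [s v <-|v] //; rewrite expn1; apply/leqW/tree_size_tl.
- by move=> c pc a pa b pb; apply: polyf_if.
- move=> a pa b pb; exact: (polyf_comp (polyf_node pa polyf_id) (polyf_flatmap pb)).
- move=> a pa b pb; exact: (polyf_comp (polyf_node pa pb) polyf_drop).
- move=> a pa b pb; exact: (polyf_comp (polyf_node pa pb) polyf_eq).
- move=> a pa; exact: (polyf_comp pa polyf_tails).
- move=> f pf a pa; exact: (polyf_comp pa pf).
Qed.

(** * The gadget: value of a coloring *)

Lemma sum_bool_le1 (T : finType) (P : pred T) :
  (forall x y, P x -> P y -> x = y) -> \sum_x P x = [exists x, P x].
Proof.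
move=> inj; case: existsP => [[x Px]|nex].
  by rewrite (bigD1 x) //= Px big1 // => y yx; case Py: (P y) => //; rewrite (inj _ _ Py Px) eqxx in yx.
by rewrite big1 // => x _; case Px: (P x) => //; case: nex; exists x.
Qed.

Lemma sum_bool_card (T : finType) (P : pred T) : \sum_x P x = #|[set x | P x]|.
Proof. by rewrite -sum1dep_card [RHS]big_mkcond; apply: eq_bigr => x _; case: (P x). Qed.

Lemma sum_pair (I J : finType) (F : I * J -> nat) :
  \sum_p F p = \sum_i \sum_j F (i, j).
Proof. by rewrite (pair_bigA _ (fun i j => F (i, j))); apply: eq_bigr => -[]. Qed.

Section Gadget.

Variables (B J A E : finType) (L W : nat).

(* [B] indexes blocks, [J] the groups of a block, [A] the assignments of a group
   and [E] the constraints.  A cover vertex is a group (left) or an anchor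
   (right); the others are pendants of anchors, common neighbours of a group and
   an anchor, and constraints, in this order. *)
Definition svert := (B * J + B * A)%type.
Definition ivert := (B * A * 'I_L + B * J * A * 'I_W + E)%type.

Variable Ne : E -> pred svert.

Definition inc (x : svert) (u : ivert) : bool :=
  match u with
  | inl (inl p) => x == inr p.1
  | inl (inr p) => (x == inl p.1.1) || (x == inr (p.1.1.1, p.1.2))
  | inr e => Ne e x
  end.

(** What a satisfying assignment earns: one unit for each pendant and each common neighbour, a
    second one for the [W] common neighbours of each group and its chosen anchor, and two for each
    constraint vertex. *)
Definition target : nat :=
  #|{: B * A}| * L + #|{: B * J}| * #|A| * W + #|{: B * J}| * W + #|E| * 2.

(** All edges join a cover vertex to an independent one, so the gains of the independent vertices
    add up to the value of a partition. *)
Definition gain (K : eqType) (cs : svert -> K) (ci : ivert -> K) (u : ivert) : nat :=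
  \sum_x (inc x u && (cs x == ci u)).

Section UpperBound.

Variables (K : finType) (cs : svert -> K) (ci : ivert -> K) (C U D : nat) (a0 : A).

Hypothesis cap_pend : forall k, #|[set p | ci (inl (inl p)) == k]| <= C.
Hypothesis degU : forall b, #|[set e | Ne e (inr b)]| <= U.
Hypothesis degW : forall v, #|[set e | Ne e (inl v)]| < W.
Hypothesis dist : forall e b j j', Ne e (inl (b, j)) -> Ne e (inl (b, j')) -> j = j'.
Hypothesis CD : C <= 4 * D.
Hypothesis LD : L = 3 * D.
Hypothesis DU : U + W * #|J| < D.

Let anchors k := #|[set b | cs (inr b) == k]|.
Let lonely b := anchors (cs (inr b)) == 1.
Let good (v : B * J) := (anchors (cs (inl v)) == 1) && [exists a, cs (inr (v.1, a)) == cs (inl v)].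
Let choice (v : B * J) : A := odflt a0 [pick a | cs (inr (v.1, a)) == cs (inl v)].
Let satisfied e := [exists v, Ne e (inl v) && Ne e (inr (v.1, choice v))].
Let nonlonely := #|[set b | ~~ lonely b]|.
Let bad := #|[set v | ~~ good v]|.

Lemma anchors1 k b b' : anchors k == 1 -> cs (inr b) == k -> cs (inr b') == k -> b = b'.
Proof.
move=> /cards1P[c ec] hb hb'.
have /set1P-> : b \in [set c] by rewrite -ec inE.
by have /set1P-> : b' \in [set c] by rewrite -ec inE.
Qed.

Lemma gain_pend p : gain cs ci (inl (inl p)) = (ci (inl (inl p)) == cs (inr p.1)).
Proof.
rewrite /gain (bigD1 (inr p.1)) //= eqxx /= big1 ?addn0 1?eq_sym // => x /negPf xp.
by rewrite xp.
Qed.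

Lemma gain_x p : gain cs ci (inl (inr p)) <=
  1 + (cs (inl p.1.1) == cs (inr (p.1.1.1, p.1.2))).
Proof.
rewrite /gain (bigD1 (inl p.1.1)) //= eqxx /= (bigD1 (inr (p.1.1.1, p.1.2))) //= eqxx ?orbT /=.
rewrite big1 ?addn0; last by move=> x /andP[/negPf-> /negPf->].
case: (cs _ =P ci _) => [->|_]; case: (cs _ =P ci _) => [->|_] //; rewrite ?eqxx //.
Qed.

(** Count coalition by coalition. With [k >= 2] anchors, a coalition holds at most
    [C <= 4 * D <= 2 * k * D] pendants instead of the desired [k * L = 3 * k * D], so at least [D]
    is lost for each of its anchors. *)
Lemma sum_pend : \sum_p gain cs ci (inl (inl p)) + nonlonely * D <= #|{: B * A}| * L.
Proof.
under eq_bigr do rewrite gain_pend.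
rewrite sum_pair /=.
rewrite /nonlonely -sum_bool_card big_distrl /= -big_split /=.
rewrite -sum_nat_const.
rewrite (partition_big (fun b => cs (inr b)) predT) //=.
rewrite [leqRHS](partition_big (fun b => cs (inr b)) predT) //=.
apply: leq_sum => k _.
have anE : anchors k = \sum_(b | cs (inr b) == k) 1.
  by rewrite /anchors -sum1dep_card.
have [lt2|ge2] := ltnP (anchors k) 2.
  apply: leq_sum => b /eqP bk.
  have -> : lonely b.
    rewrite /lonely bk eqn_leq -ltnS lt2 /=.
    by rewrite card_gt0; apply/set0Pn; exists b; rewrite inE bk.
  rewrite mul0n addn0 -[leqRHS]card_ord -sum1_card; apply: leq_sum => w _.
  exact: leq_b1.
apply: leq_trans (_ : C + anchors k * D <= _).
  rewrite big_split /=; apply: leq_add; last first.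
    by rewrite anE big_distrl; apply: leq_sum => b _; case: (lonely b); rewrite /= ?mul0n ?mul1n.
  apply: leq_trans (cap_pend k); rewrite -sum_bool_card.
  rewrite sum_pair /=.
  rewrite [leqRHS](bigID (fun b => cs (inr b) == k)) /=; apply: leq_trans (leq_addr _ _).
  by apply: leq_sum => b /eqP->.
rewrite sum_nat_const LD.
have -> : #|[pred b | cs (inr b) == k]| = anchors k.
  by rewrite /anchors cardsE.
by nia.
Qed.

(** A second unit at a common neighbour requires its group and its anchor to be together. In a
    coalition with exactly one anchor, a group gets this for at most one anchor, and only if it is
    good. Otherwise every anchor it meets is not lonely, and such an anchor is charged at most [W]
    for each of the [#|J|] groups of its block. *)
Lemma sum_x : \sum_p gain cs ci (inl (inr p)) + bad * W <=
  #|{: B * J}| * #|A| * W + #|{: B * J}| * W + nonlonely * (W * #|J|).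
Proof.
apply: leq_trans (_ : \sum_p (1 + (cs (inl p.1.1) == cs (inr (p.1.1.1, p.1.2)))) + bad * W <= _).
  by rewrite leq_add2r; apply: leq_sum => p _; apply: gain_x.
rewrite big_split /= sum1_card !card_prod !card_ord -!addnA leq_add2l.
rewrite sum_pair /=.
under eq_bigr do rewrite sum_nat_const card_ord.
rewrite -big_distrr /=.
rewrite sum_pair /=.
have key v : \sum_a (cs (inl v) == cs (inr (v.1, a))) <=
    good v + \sum_a (~~ lonely (v.1, a)).
  have [a1|na1] := boolP (anchors (cs (inl v)) == 1).
    rewrite sum_bool_le1; last first.
      by move=> x y hx hy; have := anchors1 a1 (b := (v.1, x)) (b' := (v.1, y));
        rewrite eq_sym hx eq_sym hy => /(_ isT isT) [].
    rewrite /good a1 /=; apply: leq_trans (leq_addr _ _).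
    by under eq_existsb do rewrite eq_sym.
  rewrite /good (negPf na1) add0n; apply: leq_sum => a _.
  by case: eqP => // e; rewrite /lonely -e na1.
apply: leq_trans (_ : W * \sum_v (good v + \sum_a (~~ lonely (v.1, a))) + bad * W <= _).
  by rewrite leq_add2r leq_mul2l leq_sum ?orbT.
rewrite big_split /= mulnDr [_ * W]mulnC [_ * W]mulnC addnAC -mulnDr.
have -> : \sum_v good v + bad = #|B| * #|J|.
  rewrite /bad sum_bool_card -card_prod -(cardsC [set x | good x]); congr addn.
  by apply: eq_card => v; rewrite !inE.
rewrite leq_add2l.
have -> : \sum_(v : B * J) \sum_a (~~ lonely (v.1, a)) = nonlonely * #|J|.
  rewrite sum_pair /=.
  under eq_bigr do rewrite sum_nat_const.
  rewrite -big_distrr /= mulnC; congr muln.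
  by rewrite /nonlonely -sum_bool_card sum_pair.
by rewrite mulnCA.
Qed.

(** In one coalition a constraint meets at most one lonely anchor, and at most one good group: the
    single anchor fixes the block, and [dist] allows one group per block. If both are present, the
    anchor is the choice of the group and the constraint is satisfied. The two sums charge the other
    neighbours to anchors that are not lonely and to bad groups. *)
Lemma gain_e e : gain cs ci (inr e) <= 1 + satisfied e +
  (\sum_b (Ne e (inr b) && ~~ lonely b) + \sum_v (Ne e (inl v) && ~~ good v)).
Proof.
rewrite /gain /= big_sumType /=; set k := ci (inr e).
pose P b := [&& Ne e (inr b), cs (inr b) == k & lonely b].
pose Q v := [&& Ne e (inl v), cs (inl v) == k & good v].
apply: leq_trans (_ : (\sum_b P b + \sum_v Q v) +
   (\sum_b (Ne e (inr b) && ~~ lonely b) + \sum_v (Ne e (inl v) && ~~ good v)) <= _).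
  rewrite addnACA addnC leq_add // -big_split /=; apply: leq_sum => x _;
    rewrite /P /Q; case: (Ne _ _) => //=; case: (cs _ == _) => //=.
  - by case: (lonely x).
  - by case: (good x).
rewrite leq_add2r.
have P1 x y : P x -> P y -> x = y.
  move=> /and3P[_ /eqP xk lx] /and3P[_ yk _].
  by apply: (@anchors1 k) => //; rewrite ?xk // -xk.
have QB v b : good v -> cs (inl v) == k -> cs (inr b) == k -> (v.1, choice v) = b.
  move=> /andP[a1 /existsP[a ha]] /eqP vk bk; apply: (anchors1 a1); last by rewrite vk.
  by rewrite /choice; case: pickP => [a' //|/(_ a)]; rewrite ha.
have Q1 x y : Q x -> Q y -> x = y.
  move=> /and3P[ex xk gx] /and3P[ey yk gy].
  have /andP[ay /existsP[a ha]] := gy.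
  have e1 := QB _ (y.1, a) gx xk.
  rewrite (eqP ha) in e1; have [x1 _] := e1 yk.
  case: x y ex ey x1 {xk gx yk gy ay ha e1} => [xb xj] [yb yj] /= ex ey xy.
  by rewrite xy in ex *; rewrite (dist ex ey).
rewrite (sum_bool_le1 P1) (sum_bool_le1 Q1).
case: existsP => [[b /and3P[eb bk lb]]|_]; last by case: existsP; case: (satisfied e).
case: existsP => [[v /and3P[ev vk gv]]|_]; last by case: (satisfied e).
suff -> : satisfied e by [].
by apply/existsP; exists v; rewrite ev /= (QB v b gv vk bk).
Qed.

(* An anchor sharing its coalition with another anchor loses more pendants than
   its remaining neighbours can gain, and a group whose coalition does not have
   exactly one anchor, of its own block, loses [W], more than its constraint
   vertices can gain. *)
Lemma gain_upper :
  \sum_u gain cs ci u + nonlonely + bad + #|[set e | ~~ satisfied e]| <= target.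
Proof.
rewrite big_sumType /= big_sumType /=.
have hp := sum_pend; have hx := sum_x.
have he : \sum_e gain cs ci (inr e) + #|[set e | ~~ satisfied e]| <=
    #|E| * 2 + (nonlonely * U + bad * W.-1).
  have h1 : \sum_e gain cs ci (inr e) <= \sum_e (1 + satisfied e +
      (\sum_b (Ne e (inr b) && ~~ lonely b) + \sum_v (Ne e (inl v) && ~~ good v))).
    by apply: leq_sum => e _; apply: gain_e.
  apply: leq_trans (leq_add h1 (leqnn _)) _.
  rewrite big_split /= -addnA [X in _ + X]addnC addnA; apply: leq_add.
    rewrite -sum_bool_card -big_split /= -sum_nat_const; apply: leq_sum => e _.
    by case: (satisfied e).
  rewrite big_split /=; apply: leq_add.
    rewrite exchange_big /= /nonlonely -sum_bool_card big_distrl /=; apply: leq_sum => b _.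
    case: (lonely b) => /=; first by rewrite big1 // => e _; rewrite andbF.
    rewrite mul1n; apply: leq_trans (degU b); rewrite -sum_bool_card; apply: leq_sum => e _.
    by rewrite andbT.
  rewrite exchange_big /= /bad -sum_bool_card big_distrl /=; apply: leq_sum => v _.
  case: (good v) => /=; first by rewrite big1 // => e _; rewrite andbF.
  rewrite mul1n -ltnS prednK; last by apply: leq_ltn_trans (degW v).
  apply: leq_trans (degW v); rewrite ltnS -sum_bool_card; apply: leq_sum => e _.
  by rewrite andbT.
have hD : nonlonely + nonlonely * U + nonlonely * (W * #|J|) <= nonlonely * D.
  by have := leq_mul (leqnn nonlonely) DU; rewrite mulnS mulnDr addnA.
have hW : bad * W.-1 + bad <= bad * W.
  (* Positivity of [W] comes from [degW], which needs some group to be applied to; without groups,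
     [bad] is 0. *)
  have [v0|noV] := pickP (@predT (B * J)); last first.
    by have -> : bad = 0 by apply: eq_card0 => v; have := noV v.
  by rewrite addnC -mulnS prednK //; apply: leq_ltn_trans (degW v0).
rewrite /target; move: hp hx he hD hW.
set s1 := bigop _ _ _; set s2 := bigop _ _ _; set s3 := bigop _ _ _.
lia.
Qed.

(** By [gain_upper], each unsatisfied constraint costs a unit of the target; the assignment is
    [choice]. *)
Lemma gain_target_satisfied : target <= \sum_u gain cs ci u ->
  exists f : B * J -> A, forall e, exists v, Ne e (inl v) && Ne e (inr (v.1, f v)).
Proof.
move=> hT; exists choice => e; apply/existsP; apply: contraT => ne.
have := gain_upper; have : 0 < #|[set e | ~~ satisfied e]|.
  by rewrite card_gt0; apply/set0Pn; exists e; rewrite inE.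
by lia.
Qed.

End UpperBound.

Section LowerBound.

Variables (f : B * J -> A) (U : nat).

Hypothesis degB : forall b, #|[set e | [exists j, Ne e (inl (b, j))]]| <= U.
Hypothesis sat : forall e, exists v, Ne e (inl v) && Ne e (inr (v.1, f v)).

(** The intended solution has one coalition per anchor. In [icol], common neighbours follow their
    anchor, so they gain one unit in any case and a second one when the group is there too; a
    constraint vertex follows one of its true literals. *)
Definition scol (x : svert) : B * A :=
  match x with inl v => (v.1, f v) | inr b => b end.

Definition icol (u : ivert) : B * A :=
  match u with
  | inl (inl p) => p.1
  | inl (inr p) => (p.1.1.1, p.1.2)
  | inr e => let v := xchoose (sat e) in (v.1, f v)
  end.

Lemma gain_lower : target <= \sum_u gain scol icol u.
Proof.
rewrite big_sumType /= big_sumType /= /target.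
have h3 : #|E| * 2 <= \sum_e gain scol icol (inr e).
  rewrite -sum_nat_const; apply: leq_sum => e _.
  rewrite /gain /=; set v := xchoose _.
  have /andP[h1 h2] := xchooseP (sat e).
  rewrite (bigD1 (inl v)) //= (bigD1 (inr (v.1, f v))) //=.
  by rewrite h1 h2 /= !eqxx addnA; apply: leq_addr.
have h1 : #|{: B * A}| * L <= \sum_p gain scol icol (inl (inl p)).
  rewrite -[L in _ * L]card_ord -card_prod -sum1_card; apply: leq_sum => p _.
  by rewrite /gain (bigD1 (inr p.1)) //= !eqxx; apply: leq_addr.
have h2 : #|{: B * J}| * #|A| * W + #|{: B * J}| * W <= \sum_p gain scol icol (inl (inr p)).
  apply: (@leq_trans (\sum_(p : B * J * A * 'I_W) (1 + (f p.1.1 == p.1.2)))).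
    rewrite big_split /= sum1_card !card_prod card_ord leq_add2l.
    rewrite sum_pair /= sum_pair /=.
    have -> : #|B| * #|J| * W = \sum_(v : B * J) W by rewrite sum_nat_const card_prod.
    apply: leq_sum => v _; rewrite (bigD1 (f v)) //= eqxx sum_nat_const card_ord muln1.
    exact: leq_addr.
  apply: leq_sum => p _.
  rewrite /gain (bigD1 (inl p.1.1)) //= (bigD1 (inr (p.1.1.1, p.1.2))) //= !eqxx /=.
  by rewrite xpair_eqE eqxx /=; lia.
move: h1 h2 h3; set s1 := bigop _ _ _; set s2 := bigop _ _ _; set s3 := bigop _ _ _.
lia.
Qed.

(** In the worst case all groups of the block choose this anchor and all constraints meeting the
    block join it: one anchor, [#|J|] groups, [#|J| * W] common neighbours, [U] constraint vertices
    and [L] pendants. *)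
Lemma class_size k : \sum_x (scol x == k) + \sum_u (icol u == k) <=
  (1 + #|J| + #|J| * W + U) + L.
Proof.
rewrite big_sumType /= big_sumType /= big_sumType /=; case: k => kb ka.
have h1 : \sum_(v : B * J) ((v.1, f v) == (kb, ka)) <= #|J|.
  rewrite sum_pair /= (bigD1 kb) //= [X in _ + X]big1 ?addn0.
    by rewrite -sum1_card; apply: leq_sum => j _; apply: leq_b1.
  by move=> b /negPf nb; rewrite big1 // => j _; rewrite xpair_eqE nb.
have h2 : \sum_(b : B * A) (b == (kb, ka)) = 1.
  by rewrite (bigD1 (kb, ka)) //= eqxx big1 // => b /negPf->.
have h3 : \sum_(p : B * A * 'I_L) (p.1 == (kb, ka)) = L.
  rewrite sum_pair /= (bigD1 (kb, ka)) //= [X in _ + X]big1 ?addn0.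
    by rewrite eqxx sum_nat_const card_ord muln1.
  by move=> b /negPf nb; rewrite big1 // => j _; rewrite nb.
have h4 : \sum_(p : B * J * A * 'I_W) ((p.1.1.1, p.1.2) == (kb, ka)) = #|J| * W.
  rewrite sum_pair /= sum_pair /= sum_pair /= (bigD1 kb) //= [X in _ + X]big1 ?addn0.
    rewrite -sum_nat_const; apply: eq_bigr => j _; rewrite (bigD1 ka) //= [X in _ + X]big1 ?addn0.
      by rewrite eqxx sum_nat_const card_ord muln1.
    by move=> a /negPf na; rewrite big1 // => w _; rewrite xpair_eqE na andbF.
  move=> b /negPf nb; rewrite big1 // => j _; rewrite big1 // => a _; rewrite big1 // => w _.
  by rewrite xpair_eqE nb.
have h5 : \sum_e (((xchoose (sat e)).1, f (xchoose (sat e))) == (kb, ka)) <= U.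
  apply: leq_trans (degB kb); rewrite -sum_bool_card; apply: leq_sum => e _.
  case: eqP => // -[eb _]; rewrite lt0b; apply/existsP; exists (xchoose (sat e)).2.
  by rewrite -eb -surjective_pairing; have /andP[] := xchooseP (sat e).
move: h1 h2 h3 h4 h5.
set s1 := bigop _ _ _; set s2 := bigop _ _ _; set s3 := bigop _ _ _.
set s4 := bigop _ _ _; set s5 := bigop _ _ _.
by clearbody s1 s2 s3 s4 s5 => h1 -> -> -> h5; move: (#|J| * W) h1 => JW; move: #|J| => cJ h1; lia.
Qed.

End LowerBound.

End Gadget.

(** * Values of partitions and incidence graphs *)

(** Mapping ordered pairs to unordered ones has fibres of size exactly two, because adjacency is
    irreflexive. *)
Lemma card_adj_pairs (G : graph) (B : {set 'I_(nverts G)}) :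
  \sum_(x in B) \sum_(y in B) adj G x y = 2 * #|induced_edges G B|.
Proof.
pose X := [set p : 'I_(nverts G) * 'I_(nverts G) | [&& adj G p.1 p.2, p.1 \in B & p.2 \in B]].
pose h (p : 'I_(nverts G) * 'I_(nverts G)) := [set p.1; p.2].
have -> : \sum_(x in B) \sum_(y in B) adj G x y = #|X|.
  rewrite pair_big /= -sum1_card big_mkcond [RHS]big_mkcond; apply: eq_bigr => -[x y] _ /=.
  by rewrite inE /=; case: (x \in B); case: (y \in B); case: (adj G x y).
have -> : induced_edges G B = h @: X.
  apply/setP => f; rewrite !inE; apply/andP/imsetP.
    move=> [/imset2P[x y _ /= xy ->]]; rewrite subUset !sub1set => /andP[xB yB].
    exists (x, y) => //; rewrite inE /= xB yB !andbT.
    by move: xy; rewrite !inE.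
  move=> [[x y]]; rewrite inE /= => /and3P[xy xB yB] ->; split.
    by apply/imset2P; exists x y => //; rewrite !inE /= xy.
  by rewrite subUset !sub1set xB yB.
rewrite -sum1_card (partition_big h (mem (h @: X))) /=; last by move=> p; apply: imset_f.
rewrite mulnC -sum_nat_const; apply: eq_bigr => f /imsetP[[x y]]; rewrite inE /=.
move=> /and3P[xy xB yB] ->.
have xney : x != y by apply: contraTneq xy => ->; rewrite adj_irrefl.
have -> : 2 = #|[set (x, y); (y, x)]| by rewrite cards2 xpair_eqE negb_and xney.
rewrite sum1dep_card; apply: eq_card => -[a b]; rewrite !inE /= !xpair_eqE /h /=.
apply/andP/orP.
  move=> [/and3P[ab aB bB] /eqP e].
  have : a \in [set x; y] by rewrite -e !inE eqxx.
  have : b \in [set x; y] by rewrite -e !inE eqxx orbT.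
  have aneb : a != b by apply: contraTneq ab => ->; rewrite adj_irrefl.
  rewrite !inE => /orP[]/eqP eb /orP[]/eqP ea; move: aneb; rewrite ea eb ?eqxx //; last by left.
  by right.
move=> [|] /andP[/eqP-> /eqP->]; first by rewrite xy xB yB eqxx.
by rewrite adj_sym xy xB yB setUC eqxx.
Qed.

Lemma value_pairs (G : graph) P : partition P [set: 'I_(nverts G)] ->
  \sum_x \sum_y (adj G x y && (pblock P x == pblock P y)) = 2 * value G P.
Proof.
move=> /and3P[/eqP cov triv _]; rewrite /value big_distrr /=.
under [RHS]eq_bigr do rewrite -card_adj_pairs.
have cT x : x \in cover P by rewrite cov inE.
transitivity (\sum_(x in cover P) \sum_(y in pblock P x) adj G x y).
  rewrite [RHS]big_mkcond; apply: eq_bigr => x _; rewrite cT [RHS]big_mkcond.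
  by apply: eq_bigr => y _; rewrite eq_pblock //; case: (y \in _); case: (adj G x y).
rewrite big_trivIset //; apply: eq_bigr => B BP; apply: eq_bigr => x xB.
by rewrite (def_pblock triv BP xB).
Qed.

(** The left side is what a program can count on an output list. Disjoint nonempty lists give
    distinct sets, so no blocks are merged on the right. *)
Lemma value_seq (G : graph) (s : seq (seq 'I_(nverts G))) :
  uniq (flatten s) -> [::] \notin s ->
  \sum_(b <- s) \sum_(x <- b) \sum_(y <- b) adj G x y =
  2 * value G [set:: [seq [set:: b] | b <- s]].
Proof.
move=> us s0.
have ub b : b \in s -> uniq b.
  elim: s us {s0} => //= c s IH; rewrite cat_uniq => /and3P[uc _ us].
  by rewrite inE => /orP[/eqP->|/IH->].
have uB : uniq [seq [set:: b] | b <- s].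
  elim: s us s0 {ub} => //= c s IH; rewrite cat_uniq inE negb_or => /and3P[uc dis us] /andP[c0 s0].
  rewrite IH // andbT; apply/mapP => -[b bs /setP e].
  case: c c0 uc dis e => // x c _ uc dis /(_ x); rewrite !inE eqxx /= => /esym xb.
  by move/hasP: dis; apply; exists x; rewrite ?inE ?eqxx //; apply/flattenP; exists b.
rewrite /value (eq_bigl (mem [seq [set:: b] | b <- s])); last by move=> B; rewrite inE.
rewrite -big_uniq //= big_map big_distrr /= [LHS]big_seq [RHS]big_seq.
apply: eq_bigr => b bs; rewrite -card_adj_pairs big_uniq ?ub //=.
apply: eq_big => [x|x _]; first by rewrite inE.
by rewrite big_uniq ?ub //; apply: eq_bigl => y; rewrite inE.
Qed.

Section IncidenceGraph.

Variables (S I : finType) (inc : S -> I -> bool) (vs : seq (S + I)).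
Hypotheses (uniq_vs : uniq vs) (mem_vs : forall x, x \in vs).

Definition inc_adj (x y : S + I) : bool :=
  match x, y with
  | inl s, inr i | inr i, inl s => inc s i
  | _, _ => false
  end.

(** Vertices are numbered by an explicit list, so that the adjacency matrix has the order in which
    the program lists them. *)
Definition vert (k : 'I_(size vs)) : S + I := tnth (in_tuple vs) k.

Lemma inc_adj_sym : symmetric (fun j k => inc_adj (vert j) (vert k)).
Proof. by move=> j k /=; case: (vert j); case: (vert k). Qed.

Lemma inc_adj_irrefl : irreflexive (fun j k => inc_adj (vert j) (vert k)).
Proof. by move=> j /=; case: (vert j). Qed.

Definition inc_graph : graph := Graph inc_adj_sym inc_adj_irrefl.

Lemma vert_inj : injective vert.
Proof. by apply/tuple_uniqP. Qed.

Definition rank (x : S + I) : 'I_(size vs) := Ordinal (etrans (index_mem x vs) (mem_vs x)).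

Lemma rankK : cancel rank vert.
Proof. by move=> x; rewrite /vert (tnth_nth x) /= nth_index. Qed.

Lemma vertK : cancel vert rank.
Proof. by move=> k; apply: vert_inj; rewrite rankK. Qed.

Lemma sum_vert (F : 'I_(size vs) -> nat) :
  \sum_k F k = \sum_s F (rank (inl s)) + \sum_i F (rank (inr i)).
Proof.
rewrite (reindex rank) /=; last by apply: onW_bij; exists vert; [apply: rankK|apply: vertK].
by rewrite big_sumType.
Qed.

Lemma vc_inc_graph : vc inc_graph <= #|S|.
Proof.
pose A := [set k | if vert k is inl _ then true else false].
have cA : vertex_cover inc_graph A.
  apply/forallP => x; apply/forallP => y; apply/implyP; rewrite !inE /=.
  by case: (vert x); case: (vert y).
rewrite /vc; case: arg_minnP => [|B _ minB].
  by apply/forallP => x; apply/forallP => y; rewrite !inE orbT implybT.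
apply: leq_trans (minB _ cA) _.
rewrite -[#|S|](card_codom (@inl_inj S I)).
apply: leq_trans (subset_leq_card (_ : vert @: A \subset codom inl)).
  by rewrite card_imset //; apply: vert_inj.
apply/subsetP => x /imsetP[k]; rewrite inE => kA ->.
by case: (vert k) kA => // s _; apply: codom_f.
Qed.

Lemma value_inc_graph P : partition P [set: 'I_(size vs)] ->
  value inc_graph P =
  \sum_i \sum_s (inc s i && (pblock P (rank (inl s)) == pblock P (rank (inr i)))).
Proof.
move=> /(@value_pairs inc_graph) /= e; apply/eqP.
rewrite -(eqn_pmul2l (isT : 0 < 2)) -e sum_vert mul2n -addnn; apply/eqP; congr addn.
  rewrite [RHS]exchange_big /=; apply: eq_bigr => s _; rewrite sum_vert big1 ?add0n.
    by apply: eq_bigr => i _; rewrite !rankK.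
  by move=> s' _; rewrite !rankK.
apply: eq_bigr => i _; rewrite sum_vert [X in _ + X]big1 ?addn0.
  by apply: eq_bigr => s _; rewrite !rankK eq_sym.
by move=> s' _; rewrite !rankK.
Qed.

Lemma coloring_value (K : eqType) (cs : S -> K) (ci : I -> K) C :
  (forall k, \sum_s (cs s == k) + \sum_i (ci i == k) <= C) ->
  exists2 P, cap_partition inc_graph C P &
    value inc_graph P = \sum_i \sum_s (inc s i && (cs s == ci i)).
Proof.
pose col (x : S + I) := match x with inl s => cs s | inr i => ci i end.
move=> cap; pose P := preim_partition (col \o vert) [set: 'I_(size vs)].
have pP : partition P setT := preim_partitionP _ _.
have /and3P[/eqP cov triv _] := pP.
have pbE x y : (pblock P x == pblock P y) = (col (vert x) == col (vert y)).
  rewrite eq_pblock //; last by rewrite cov inE.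
  rewrite pblock_equivalence_partition ?inE // => a b c _ _ _; split=> //= /eqP->.
  by [].
exists P; last first.
  by rewrite value_inc_graph //; apply: eq_bigr => i _; apply: eq_bigr => s _; rewrite pbE !rankK.
rewrite /cap_partition pP /=; apply/forallP => B; apply/implyP => BP.
have [x xB] : exists x, x \in B.
  by apply/set0Pn; apply: contraTneq BP => ->; case/and3P: pP.
apply: leq_trans (cap (col (vert x))).
rewrite -(def_pblock triv BP xB) -sum1_card big_mkcond sum_vert /=.
by apply: leq_add; apply: leq_sum => s _;
  rewrite -eq_pblock // ?cov ?inE // eq_sym pbE rankK /= eq_sym; case: (_ == _).
Qed.

Lemma class_size_le C P (k : {set 'I_(size vs)}) : 0 < C -> cap_partition inc_graph C P ->
  #|[set i | pblock P (rank (inr i)) == k]| <= C.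
Proof.
move=> C0 /andP[pP /forall_inP cap]; have /and3P[/eqP cov triv _] := pP.
have [->|[i]] := set_0Vmem [set i | pblock P (rank (inr i)) == k]; first by rewrite cards0.
rewrite inE => /eqP ek.
have kP : k \in P by rewrite -ek; apply: pblock_mem; rewrite cov inE.
apply: leq_trans (cap k kP).
rewrite -(card_imset _ (f := fun i => rank (inr i))); last first.
  by move=> a b /(can_inj rankK) [].
apply: subset_leq_card; apply/subsetP => x /imsetP[j]; rewrite inE => /eqP <- ->.
by rewrite mem_pblock cov inE.
Qed.

Lemma enc_inc_graph C : enc_instance inc_graph C =
  Node (enc_seq (fun x => enc_seq (fun y => enc_bool (inc_adj x y)) vs) vs) (enc_nat C).
Proof.
have encE (enc : S + I -> tree) (enc' : 'I_(size vs) -> tree) :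
    (forall k, enc' k = enc (vert k)) -> enc_seq enc' (enum 'I_(size vs)) = enc_seq enc vs.
  move=> e; transitivity (enc_seq enc [seq vert k | k <- enum 'I_(size vs)]).
    by rewrite /enc_seq foldr_map; elim: (enum _) => //= k l ->; rewrite e.
  by rewrite [map _ _](map_tnth_enum (in_tuple vs)).
by rewrite /enc_instance /=; congr Node; apply: (encE _) => j; apply: (encE _).
Qed.

End IncidenceGraph.

(** * From 3-CNF formulas to bounded-occurrence constraints *)

(** Neighbouring pairs are read off from the suffixes because this is how the program obtains them,
    through [TTails]. *)
Definition consec (T : Type) (l : seq T) : seq (T * T) :=
  flatten [seq (if t is x :: y :: _ then [:: (x, y)] else [::]) | t <- rsuf l].

Lemma consec_cons (T : Type) (x : T) l :
  consec (x :: l) = consec l ++ (if l is y :: _ then [:: (x, y)] else [::]).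
Proof. by rewrite /consec /= map_rcons flatten_rcons; case: l. Qed.

Lemma consec_eq (T : eqType) (T' : Type) (Y : T -> T') (l : seq T) :
  (forall p, p \in consec l -> Y p.1 = Y p.2) -> {in l &, forall x y, Y x = Y y}.
Proof.
elim: l => //= x l IH h.
have {}IH : {in l &, forall x y, Y x = Y y}.
  by apply: IH => p pl; apply: h; rewrite consec_cons mem_cat pl.
have xl y : y \in l -> Y x = Y y.
  case: l IH h => // z l IH h yl; rewrite -(IH z y) ?mem_head //.
  by apply: (h (x, z)); rewrite consec_cons mem_cat mem_head orbT.
move=> a b; rewrite !inE => /orP[/eqP->|al] /orP[/eqP->|bl] //; first exact: xl.
- by rewrite (xl a).
- exact: IH.
Qed.

Lemma consec_mem (T : eqType) (l : seq T) p : p \in consec l -> (p.1 \in l) && (p.2 \in l).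
Proof.
elim: l => //= x l IH; rewrite consec_cons mem_cat => /orP[/IH/andP[h1 h2]|].
  by rewrite !inE h1 h2 !orbT.
case: l {IH} => // y l; rewrite mem_seq1 => /eqP->.
by rewrite !inE !eqxx !orbT.
Qed.

Lemma count_consec1 (T : eqType) (l : seq T) x :
  count (fun p => p.1 == x) (consec l) <= count_mem x l.
Proof.
elim: l => //= y l IH; rewrite consec_cons count_cat addnC leq_add //.
by case: l {IH} => //= z l; rewrite addn0.
Qed.

Lemma count_consec2 (T : eqType) (l : seq T) x :
  count (fun p => p.2 == x) (consec l) <= count_mem x (behead l).
Proof.
elim: l => //= y l IH; rewrite consec_cons count_cat.
by case: l IH => //= z l IH; rewrite addn0 addnC leq_add2l.
Qed.

Section Constraints.

Variables (n : nat) (phi : cnf3 n).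
Local Notation m := (size phi).

(* Every literal occurrence, the p-th literal of clause c, gets two copies of
   its variable: side [false] is used in the clause itself and side [true]
   links to the next occurrence.  Constraints then never use a part twice, and
   every copy lies in at most five constraints. *)
Definition part : Type := (bool * 'I_3)%type.
Definition occ : Type := ('I_3 * 'I_m)%type.
Definition copy : Type := (part * 'I_m)%type.
Definition elit : Type := (copy * bool)%type.

Definition occ_lit (o : occ) : literal n := tnth (tnth (in_tuple phi) o.2) o.1.
Definition copy_of (s : bool) (o : occ) : copy := ((s, o.1), o.2).

Definition occs : seq occ :=
  flatten [seq [seq (p, c) | p <- enum 'I_3] | c <- rev (enum 'I_m)].

(** Equality as the two implications between [x] and [y], in clause form. *)
Definition eq_constraints (x y : copy) : seq (seq elit) :=
  [:: [:: (x, true); (y, false)]; [:: (x, false); (y, true)]].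

Definition links : seq (occ * occ) :=
  flatten [seq consec [seq o <- occs | (occ_lit o).2 == z] | z <- enum 'I_n].

Definition clause_constraints : seq (seq elit) :=
  [seq [seq (copy_of false (p, c), (occ_lit (p, c)).1) | p <- enum 'I_3] | c <- rev (enum 'I_m)].
Definition copy_constraints : seq (seq elit) :=
  flatten [seq eq_constraints (copy_of false o) (copy_of true o) | o <- occs].
Definition link_constraints : seq (seq elit) :=
  flatten [seq eq_constraints (copy_of true p.1) (copy_of false p.2) | p <- links].

Definition constraints : seq (seq elit) :=
  clause_constraints ++ copy_constraints ++ link_constraints.

Definition csat (y : copy -> bool) (e : seq elit) : bool := has (fun l => y l.1 == l.2) e.

Lemma mem_occs o : o \in occs.
Proof.
apply/flattenP; exists [seq (p, o.2) | p <- enum 'I_3].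
  by apply: map_f; rewrite mem_rev mem_enum.
by case: o => p c; apply: map_f; rewrite mem_enum.
Qed.

Lemma uniq_occs : uniq occs.
Proof.
rewrite -[occs]/[seq (p, c) | c <- rev (enum 'I_m), p <- enum 'I_3].
by apply: allpairs_uniq => [||[? ?] [? ?] _ _ [-> ->]]; rewrite ?rev_uniq ?enum_uniq.
Qed.

Lemma csat_eq y x z : all (csat y) (eq_constraints x z) = (y x == y z).
Proof. by rewrite /csat /=; case: (y x); case: (y z). Qed.

Lemma mem_links p : p \in links -> (occ_lit p.1).2 = (occ_lit p.2).2.
Proof.
move=> /flattenP[s /mapP[z _ ->] /consec_mem]; rewrite !mem_filter.
by move=> /andP[/andP[/eqP-> _] /andP[/eqP-> _]].
Qed.

Lemma csat_eqs y (T : Type) (F G : T -> copy) s :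
  all (csat y) (flatten [seq eq_constraints (F o) (G o) | o <- s]) =
  all (fun o => y (F o) == y (G o)) s.
Proof. by elim: s => //= o s IH; rewrite -IH -csat_eq /= -!andbA. Qed.

Lemma satisfiable_constraints :
  reflect (exists y, all (csat y) constraints) (satisfiable phi).
Proof.
apply: (iffP existsP) => [[a /allP sa]|[y]].
  exists (fun x => a (occ_lit (x.1.2, x.2)).2).
  rewrite /constraints !all_cat !csat_eqs; apply/and3P; split.
  - apply/allP => e /mapP[c _ ->]; have /hasP[l lc al] := sa _ (mem_tnth c (in_tuple phi)).
    have /tnthP[p ep] := lc; apply/hasP; exists (copy_of false (p, c), (occ_lit (p, c)).1).
      by apply: map_f; rewrite mem_enum.
    by rewrite /= /occ_lit /= -ep.
  - by apply/allP => o _ /=.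
  - by apply/allP => -[[p c] [p' c']] /mem_links /= ->.
rewrite /constraints !all_cat !csat_eqs => /and3P[/allP hc /allP hcp /allP hl].
pose Y o := y (copy_of false o).
(* Two hops lead from one occurrence to the next: the copy constraint to side [true], then the link
   to side [false] of the next occurrence. *)
have Yeq o o' : (occ_lit o).2 = (occ_lit o').2 -> Y o = Y o'.
  move=> e; apply: (@consec_eq _ _ Y [seq x <- occs | (occ_lit x).2 == (occ_lit o).2]).
  - move=> p pl; have /eqP := hcp p.1 (mem_occs _).
    rewrite -/(Y p.1) => ->; apply/eqP; apply: hl.
    by apply/flattenP; eexists; last exact: pl; apply: map_f; rewrite mem_enum.
  - by rewrite mem_filter eqxx mem_occs.
  - by rewrite mem_filter e eqxx mem_occs.
(* Any occurrence of a variable gives its value; variables without occurrences get [false]. *)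
exists [ffun z => if [pick o | (occ_lit o).2 == z] is Some o then Y o else false].
apply/allP => cl cphi; have /tnthP[c ->] : cl \in in_tuple phi by [].
have cm : [seq (copy_of false (p, c), (occ_lit (p, c)).1) | p <- enum 'I_3]
    \in clause_constraints.
  by apply/mapP; exists c; rewrite ?mem_rev ?mem_enum.
have /hasP[_ /mapP[p _ ->] /= hp] := hc _ cm.
apply/hasP; exists (occ_lit (p, c)); first exact: mem_tnth.
rewrite ffunE; case: pickP => [o /eqP/Yeq->|/(_ (p, c))]; last by rewrite eqxx.
exact: hp.
Qed.

(** This is the purpose of the parts: a clause uses side [false] at three different positions, and
    an equality uses both sides. Since a part is a component of a block, the literals of a
    constraint lie in different blocks. *)
Lemma constraint_parts e : e \in constraints -> uniq [seq l.1.1 | l <- e].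
Proof.
rewrite !mem_cat => /or3P[/mapP[c _ ->]|/flattenP[_ /mapP[o _ ->]]|/flattenP[_ /mapP[p _ ->]]].
- rewrite -map_comp map_inj_uniq ?enum_uniq // => p p' [] //.
- by rewrite !inE => /orP[]/eqP->.
- by rewrite !inE => /orP[]/eqP->.
Qed.

Definition touches (x : copy) (e : seq elit) : bool := has (fun l => l.1 == x) e.

Lemma count_eqs (T : Type) (F G : T -> copy) s x :
  (forall o, F o != G o) ->
  count (touches x) (flatten [seq eq_constraints (F o) (G o) | o <- s]) =
  2 * (count (fun o => F o == x) s + count (fun o => G o == x) s).
Proof.
move=> FG; elim: s => //= o s ->; rewrite /touches /= !orbF.
have := FG o; case: (F o =P x) => [->|_]; case: (G o =P x) => [->|_]; rewrite ?eqxx //= => _; lia.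
Qed.


Lemma count_occs_by_var o :
  \sum_(z <- enum 'I_n) count_mem o [seq x <- occs | (occ_lit x).2 == z] <= 1.
Proof.
rewrite (bigD1_seq (occ_lit o).2) ?mem_enum ?enum_uniq //= big1 ?addn0.
  rewrite count_filter; apply: leq_trans (_ : count_mem o occs <= 1).
    by apply: sub_count => x /andP[].
  by rewrite count_uniq_mem ?uniq_occs //; apply: leq_b1.
move=> z zo; apply/eqP; rewrite -leqn0 leqNgt -has_count; apply/hasPn => x.
by rewrite mem_filter => /andP[/eqP ez _]; apply: contra zo => /eqP <-; rewrite ez.
Qed.

Lemma count_links1 o : count (fun p => p.1 == o) links <= 1.
Proof.
apply: leq_trans (count_occs_by_var o).
rewrite /links count_flatten sumnE !big_map; apply: leq_sum => z _.
exact: count_consec1.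
Qed.

Lemma count_links2 o : count (fun p => p.2 == o) links <= 1.
Proof.
apply: leq_trans (count_occs_by_var o).
rewrite /links count_flatten sumnE !big_map; apply: leq_sum => z _.
apply: leq_trans (count_consec2 _ _) _.
by case: [seq x <- _ | _] => //= x l; apply: leq_addl.
Qed.

Lemma copy_ofE s o x : (copy_of s o == x) = (s == x.1.1) && (o == (x.1.2, x.2)).
Proof. by case: o x => p c [[s' p'] c']; rewrite /copy_of /= !xpair_eqE andbA. Qed.

Lemma count_andb (T : Type) (b : bool) (Q : pred T) s :
  count (fun x => b && Q x) s = if b then count Q s else 0.
Proof. by case: b => //=; rewrite count_pred0. Qed.

Lemma count_touches x : count (touches x) constraints <= 5.
Proof.
(* One clause, the two implications of the copy constraint, and two implications of a link: the side
   of a copy decides at which end of a link it stands. *)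
rewrite /constraints !count_cat; apply: (@leq_trans (1 + (2 + 2))) => //.
have c1 o : count_mem o occs <= 1 by rewrite count_uniq_mem ?uniq_occs //; apply: leq_b1.
apply: leq_add; last apply: leq_add.
- rewrite /clause_constraints count_map.
  apply: (@leq_trans (count_mem x.2 (rev (enum 'I_m)))).
    by apply: sub_count => c /hasP[_ /mapP[p _ ->] /eqP <-] /=.
  by rewrite count_uniq_mem ?rev_uniq ?enum_uniq //; apply: leq_b1.
- rewrite /copy_constraints count_eqs //.
  rewrite (eq_count (fun o => copy_ofE false o x)) (eq_count (fun o => copy_ofE true o x)).
  rewrite !count_andb; have := c1 (x.1.2, x.2); rewrite -[count_mem _ _]/(count (fun o => o == _) _).
  by case: x.1.1; set k := count _ _; clearbody k => /= h; lia.
- rewrite /link_constraints count_eqs; last by case=> [[a b] [c d]].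
  rewrite (eq_count (fun p => copy_ofE true p.1 x)) (eq_count (fun p => copy_ofE false p.2 x)).
  have := count_links1 (x.1.2, x.2); have := count_links2 (x.1.2, x.2).
  rewrite !count_andb; case: x.1.1; set k := count _ _; set k' := count _ _.
    by clearbody k k' => /= h h'; lia.
  by clearbody k k' => /= h h'; lia.
Qed.

(** * Placing copies into groups, and the neighbours of constraint vertices *)

Variables (g nb : nat) (loc : 'I_m -> 'I_nb * g.-tuple bool * 'I_g) (bvs : seq (g.-tuple bool)).
Hypothesis loc_inj : injective loc.
Hypothesis mem_bvs : forall a, a \in bvs.

(** One location map on clauses serves all six parts. Groups of a block are indexed by bit vectors
    too, which gives [2 ^ g] of them. *)
Definition block : Type := (part * 'I_nb)%type.
Local Notation bits := (g.-tuple bool).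
Local Notation sv := (svert block bits bits).

Definition elit_nbrs (l : elit) : seq sv :=
  let q := loc l.1.2 in
  inl ((l.1.1, q.1.1), q.1.2) ::
  [seq inr ((l.1.1, q.1.1), a) | a <- bvs & tnth a q.2 == l.2].

Definition cnbrs (e : seq elit) : seq sv := flatten [seq elit_nbrs l | l <- e].

Definition cadj (k : 'I_(size constraints)) : pred sv :=
  fun x => x \in cnbrs (tnth (in_tuple constraints) k).

Lemma cnbrs_inl e v : reflect
  (exists2 l, l \in e & exists i, l.1.1 = v.1.1 /\ loc l.1.2 = (v.1.2, v.2, i))
  (inl v \in cnbrs e).
Proof.
apply: (iffP flattenP) => [[s /mapP[l le ->]]|[l le [i [e1 e2]]]].
  rewrite inE => /orP[/eqP[->] /=|/mapP[]//].
  by exists l => //; exists (loc l.1.2).2; split=> //; case: (loc _) => [[]].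
exists (elit_nbrs l); first exact: map_f.
by rewrite /elit_nbrs e1 e2 /= inE; case: v e1 e2 => [[? ?] ?]; rewrite eqxx.
Qed.

Lemma cnbrs_inr e b : reflect
  (exists2 l, l \in e & exists j i, [/\ l.1.1 = b.1.1, loc l.1.2 = (b.1.2, j, i) & tnth b.2 i = l.2])
  (inr b \in cnbrs e).
Proof.
apply: (iffP flattenP) => [[s /mapP[l le ->]]|[l le [j [i [e1 e2 e3]]]]].
  rewrite inE => /orP[//|/mapP[a]]; rewrite mem_filter => /andP[/eqP ha _] [->] /=.
  by exists l => //; exists (loc l.1.2).1.2, (loc l.1.2).2; split=> //; case: (loc _) => [[]].
exists (elit_nbrs l); first exact: map_f.
rewrite /elit_nbrs e1 e2 /= inE /=; apply/mapP; exists b.2.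
  by rewrite mem_filter e3 eqxx mem_bvs.
by case: b e1 e2 e3 => [[? ?] ?].
Qed.

Let cmem k : tnth (in_tuple constraints) k \in constraints.
Proof. exact: mem_tnth. Qed.

Lemma part_inj e l l' : e \in constraints -> l \in e -> l' \in e -> l.1.1 = l'.1.1 -> l = l'.
Proof.
move=> /constraint_parts; elim: e => //= x e IH /andP[xe ue].
rewrite !inE => /orP[/eqP->|le] /orP[/eqP->|le'] // ep; last exact: IH.
- by case/mapP: xe; exists l'.
- by case/mapP: xe; exists l.
Qed.

Lemma cadj_dist k b j j' : cadj k (inl (b, j)) -> cadj k (inl (b, j')) -> j = j'.
Proof.
move=> /cnbrs_inl[l le [i [e1 e2]]] /cnbrs_inl[l' le' [i' [e1' e2']]].
have ell : l = l' by apply: (part_inj (cmem k)) => //; rewrite e1 e1'.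
by move: e2'; rewrite -ell e2 => -[].
Qed.

Lemma card_tnth (T : Type) (s : seq T) (P : pred T) :
  #|[set k | P (tnth (in_tuple s) k)]| = count P s.
Proof.
rewrite -sum1dep_card -(big_tnth _ _ _ P (fun _ => 1)).
by rewrite sum1_count.
Qed.

(** Each of the [g] places of a group holds at most one copy, as [loc] is injective, and a copy lies
    in at most five constraints. *)
Lemma degree_inl v : #|[set k | cadj k (inl v)]| <= 5 * g.
Proof.
apply: (@leq_trans (\sum_(i < g) 5)); last by rewrite sum_nat_const card_ord mulnC.
pose Q (i : 'I_g) e := has (fun l : elit => (l.1.1 == v.1.1) && (loc l.1.2 == (v.1.2, v.2, i))) e.
apply: (@leq_trans (\sum_(i < g) #|[set k | Q i (tnth (in_tuple constraints) k)]|)).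
  under eq_bigr do rewrite -sum_bool_card.
  rewrite -sum_bool_card exchange_big /=; apply: leq_sum => k _.
  case: (boolP (cadj k (inl v))) => // /cnbrs_inl[l le [i [e1 e2]]]; rewrite (bigD1 i) //=.
  by have -> : Q i (tnth (in_tuple constraints) k) by apply/hasP; exists l; rewrite // e1 e2 !eqxx.
apply: leq_sum => i _; rewrite card_tnth.
have [c ec|noc] := pickP (fun c => loc c == (v.1.2, v.2, i)); last first.
  apply: leq_trans (_ : 0 <= _) => //; rewrite leqn0 -leqn0 leqNgt -has_count; apply/hasPn => e _.
  by apply/hasPn => l _; rewrite noc andbF.
apply: leq_trans (count_touches (v.1.1, c)); apply: sub_count => e /hasP[l le /andP[/eqP e1 /eqP e2]].
apply/hasP; exists l => //; rewrite -e1; apply/eqP.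
have : l.1.2 = c by apply: loc_inj; rewrite e2 (eqP ec).
by case: l.1 => a b /= ->.
Qed.

Lemma degree_block b : #|[set k | [exists j, cadj k (inl (b, j))]]| <= 5 * g * 2 ^ g.
Proof.
apply: (@leq_trans (\sum_(j : bits) 5 * g)); last by rewrite sum_nat_const card_tuple card_bool mulnC.
apply: (@leq_trans (\sum_(j : bits) #|[set k | cadj k (inl (b, j))]|)); last first.
  by apply: leq_sum => j _; apply: degree_inl.
under eq_bigr do rewrite -sum_bool_card.
rewrite -sum_bool_card exchange_big /=; apply: leq_sum => k _.
by case: existsP => // -[j hj]; rewrite (bigD1 j) //= hj.
Qed.

Lemma degree_inr b : #|[set k | cadj k (inr b)]| <= 5 * g * 2 ^ g.
Proof.
apply: leq_trans (degree_block b.1); apply: subset_leq_card; apply/subsetP => k.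
rewrite !inE => /cnbrs_inr[l le [j [i [e1 e2 _]]]]; apply/existsP; exists j.
by apply/cnbrs_inl; exists l => //; exists i.
Qed.

Lemma satisfiable_choice : satisfiable phi <->
  exists f : block * bits -> bits, forall k, exists v, cadj k (inl v) && cadj k (inr (v.1, f v)).
Proof.
split.
  move=> /satisfiable_constraints[y /allP hy].
  (* Places that hold no clause get [false]. *)
  pose f (v : block * bits) : bits :=
    [tuple [exists c, (loc c == (v.1.2, v.2, i)) && y (v.1.1, c)] | i < g].
  exists f => k; have /hasP[l le /eqP yl] := hy _ (cmem k).
  case el: (loc l.1.2) => [[be j] i].
  exists ((l.1.1, be), j); apply/andP; split; first by apply/cnbrs_inl; exists l => //; exists i.
  apply/cnbrs_inr; exists l => //; exists j, i; split=> //=.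
  rewrite tnth_mktuple /= -yl; apply/existsP/idP => [[c /andP[/eqP ec yc]]|yy].
    have ecl : c = l.1.2 by apply: loc_inj; rewrite ec el.
    by move: yc; rewrite ecl /=; case: (l.1).
  by exists l.1.2; rewrite el eqxx /=; case: (l.1) yy.
move=> [f hf]; apply/satisfiable_constraints.
exists (fun x => let q := loc x.2 in tnth (f ((x.1, q.1.1), q.1.2)) q.2).
apply/allP => e ec; have /tnthP[k ek] : e \in in_tuple constraints by [].
have [v /andP[/cnbrs_inl[l le [i [e1 e2]]] /cnbrs_inr[l' le' [j [i' [e1' e2' e3]]]]]] := hf k.
rewrite -ek in le le'; apply/hasP; exists l => //=.
(* Group and anchor share a block, hence a part, so both are neighbours on account of the same
   literal. *)
have ell : l' = l by apply: (part_inj ec) => //; rewrite e1' e1.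
rewrite ell in e2' e3; rewrite e2 in e2' *; case: e2' => /= _ ei.
rewrite -ei in e3; rewrite -e3 e1; apply/eqP; congr (tnth (f _) _).
by case: v {e1 e2 e1' e3 } => [[? ?] ?].
Qed.

Definition gW : nat := (5 * g).+1.
Definition gU : nat := 5 * g * 2 ^ g.
(** The bound of [class_size] on an intended coalition without its pendants. Together with [3 * gD]
    pendants it fills the capacity [4 * gD], and it exceeds [gU + gW * 2 ^ g], as the upper bound on
    the gain requires. *)
Definition gD : nat := (2 ^ g + (2 ^ g * gW + gU)).+1.
Definition gL : nat := 3 * gD.
Definition gC : nat := 4 * gD.

Local Notation iv := (ivert block bits bits 'I_(size constraints) gL gW).
Local Notation ginc := (@inc block bits bits 'I_(size constraints) gL gW cadj).
Local Notation gtarget := (target block bits bits 'I_(size constraints) gL gW).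

Lemma reduction_correct (vs : seq (sv + iv)) (uniq_vs : uniq vs) (mem_vs : forall x, x \in vs) P :
  optimal_partition (inc_graph ginc vs) gC P ->
  (gtarget <= value (inc_graph ginc vs) P) = satisfiable phi.
Proof.
move=> [capP maxP]; have pP : partition P [set: 'I_(size vs)] by case/andP: capP.
have cJ : #|{: bits}| = 2 ^ g by rewrite card_tuple card_bool.
apply/idP/idP => [|/satisfiable_choice[f hf]].
  rewrite (value_inc_graph ginc uniq_vs mem_vs) // => hT; apply/satisfiable_choice.
  apply: (@gain_target_satisfied block bits bits 'I_(size constraints) gL gW cadj _
    (fun x => pblock P (rank mem_vs (inl x))) (fun u => pblock P (rank mem_vs (inr u)))
    gC gU gD [tuple of nseq g false]) => //.
  - move=> k; apply: leq_trans (class_size_le mem_vs k _ capP) => //.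
    have inj : injective (fun p => inl (inl p) : iv) by move=> p p' [].
    rewrite -(card_imset _ inj).
    by apply: subset_leq_card; apply/subsetP => u /imsetP[p]; rewrite !inE => hp ->.
  - exact: degree_inr.
  - by move=> v; rewrite ltnS; apply: degree_inl.
  - exact: cadj_dist.
  - by rewrite cJ /gD addnC mulnC ltnS leq_addl.
have cap k : \sum_s (scol f s == k) + \sum_i (@icol _ _ _ _ gL gW _ _ hf i == k) <= gC.
  apply: leq_trans (class_size gL gW degree_block hf k) _.
  by rewrite cJ /gC /gL /gD -/gU; lia.
have [Q capQ vQ] := coloring_value ginc uniq_vs mem_vs cap.
by apply: leq_trans (maxP _ capQ); rewrite vQ; apply: gain_lower.
Qed.

End Constraints.

(** * Programming with terms *)

Lemma enc_seqE (T : Type) (e : T -> tree) s : enc_seq e s = unlist [seq e x | x <- s].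
Proof. by elim: s => //= x s ->. Qed.

Lemma tolist_enc (T : Type) (e : T -> tree) s : tolist (enc_seq e s) = [seq e x | x <- s].
Proof. by rewrite enc_seqE unlistK. Qed.

Lemma enc_nat_nseq k : enc_nat k = unlist (nseq k Leaf).
Proof. by elim: k => //= k <-. Qed.

Lemma size_enc_nat k : size (tolist (enc_nat k)) = k.
Proof. by rewrite enc_nat_nseq unlistK size_nseq. Qed.

Lemma size_tolist_enc (T : Type) (e : T -> tree) s : size (tolist (enc_seq e s)) = size s.
Proof. by rewrite tolist_enc size_map. Qed.

Lemma enc_nat_inj : injective enc_nat.
Proof. by move=> a b e; rewrite -(size_enc_nat a) e size_enc_nat. Qed.

Lemma enc_bool_inj : injective enc_bool. Proof. by case; case. Qed.

Lemma enc_seq_inj (T : Type) (e : T -> tree) : injective e -> injective (enc_seq e).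
Proof. by move=> ie; elim=> [|x s IH] [|y t] //= [/ie-> /IH->]. Qed.

Lemma den_for (TA TB : Type) (ea : TA -> tree) (eb : TB -> tree) a b v s (F : TA -> seq TB) :
  den a v = enc_seq ea s -> (forall x, den b (Node (ea x) v) = enc_seq eb (F x)) ->
  den (TFor a b) v = enc_seq eb (flatten [seq F x | x <- s]).
Proof.
move=> ha hb; rewrite /= /flatmap /= ha tolist_enc -map_comp enc_seqE map_flatten -map_comp.
by congr (unlist (flatten _)); apply: eq_map => x /=; rewrite hb tolist_enc.
Qed.

Definition single (a : term) : term := TNode a TLeaf.

Lemma den_map (TA TB : Type) (ea : TA -> tree) (eb : TB -> tree) a b v s (F : TA -> TB) :
  den a v = enc_seq ea s -> (forall x, den b (Node (ea x) v) = eb (F x)) ->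
  den (TFor a (single b)) v = enc_seq eb [seq F x | x <- s].
Proof.
move=> ha hb; rewrite (den_for (eb := eb) (F := fun x => [:: F x]) ha).
  by congr enc_seq; elim: s {ha} => //= x s ->.
by move=> x; rewrite /= hb.
Qed.

Lemma den_filter (T : Type) (e : T -> tree) a c v s (P : pred T) :
  den a v = enc_seq e s -> (forall x, is_node (den c (Node (e x) v)) = P x) ->
  den (TFor a (TIf c (single (TVar 0)) TLeaf)) v = enc_seq e [seq x <- s | P x].
Proof.
move=> ha hc; rewrite (den_for (eb := e) (F := fun x => if P x then [:: x] else [::]) ha).
  by congr enc_seq; elim: s {ha} => //= x s ->; case: (P x).
by move=> x; rewrite /= hc; case: (P x).
Qed.

Definition args (l : seq term) : term := foldr TNode TLeaf l.
Definition call (f : term) (l : seq term) : term := TCall f (args l).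
Definition unit_list : term := single TLeaf.
Definition ttrue : term := TNode TLeaf TLeaf.

Fixpoint quote (t : tree) : term := if t is Node a b then TNode (quote a) (quote b) else TLeaf.
Lemma den_quote t v : den (quote t) v = t.
Proof. by elim: t => //= a -> b ->. Qed.

Definition tlen : term := TFor (TVar 0) unit_list.
Definition tmul : term := TFor (TVar 0) (TFor (TVar 2) unit_list).
Definition tcat : term := TFor (args [:: TVar 0; TVar 1]) (TVar 0).
(** The nonempty suffixes of a unary number, shortest first and each without its head, are the unary
    numbers from 0 on. *)
Definition tiota : term := TFor (TTails (TVar 0)) (single (TTl (TVar 0))).

Lemma flatten_nseq (T T' : Type) (s : seq T) k (x : T') :
  flatten [seq nseq k x | _ <- s] = nseq (size s * k) x.
Proof. by elim: s => //= _ s ->; rewrite mulSn nseqD. Qed.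

Lemma den_len a v : den (call tlen [:: a]) v = enc_nat (size (tolist (den a v))).
Proof.
rewrite /= /flatmap /= enc_nat_nseq; congr unlist.
by rewrite -[[:: Leaf]]/(nseq 1 Leaf) flatten_nseq muln1.
Qed.

Lemma den_mul a b v : den (call tmul [:: a; b]) v =
  enc_nat (size (tolist (den a v)) * size (tolist (den b v))).
Proof.
rewrite /= /flatmap /= enc_nat_nseq; congr unlist.
rewrite -[[:: Leaf]]/(nseq 1 Leaf) !flatten_nseq muln1 -(flatten_nseq (tolist (den a v))).
by congr flatten; apply: eq_map => x; rewrite unlistK.
Qed.

Lemma den_cat a b v : den (call tcat [:: a; b]) v = unlist (tolist (den a v) ++ tolist (den b v)).
Proof. by rewrite /= /flatmap /= cats0. Qed.

Lemma den_cat_seq (T : Type) (e : T -> tree) a b v s t :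
  den a v = enc_seq e s -> den b v = enc_seq e t ->
  den (call tcat [:: a; b]) v = enc_seq e (s ++ t).
Proof. by move=> ha hb; rewrite den_cat ha hb !tolist_enc -map_cat -enc_seqE. Qed.

Lemma den_cat_nat a b v j k : den a v = enc_nat j -> den b v = enc_nat k ->
  den (call tcat [:: a; b]) v = enc_nat (j + k).
Proof. by move=> ha hb; rewrite den_cat ha hb !enc_nat_nseq !unlistK nseqD. Qed.

Lemma den_mul_nat a b v j k : den a v = enc_nat j -> den b v = enc_nat k ->
  den (call tmul [:: a; b]) v = enc_nat (j * k).
Proof. by move=> ha hb; rewrite den_mul ha hb !size_enc_nat. Qed.

Lemma den_iota a v k : den a v = enc_nat k ->
  den (call tiota [:: a]) v = enc_seq enc_nat (iota 0 k).
Proof.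
move=> ha; rewrite /= ha /flatmap /= /tailsf unlistK -map_comp enc_seqE; congr unlist.
rewrite enc_nat_nseq unlistK {a v ha}; elim: k => // k IH.
rewrite -[nseq k.+1 _]/(Leaf :: nseq k Leaf) /rsuf -/(rsuf (nseq k Leaf)) map_rcons flatten_rcons IH.
by rewrite -addn1 iotaD map_cat /= enc_nat_nseq.
Qed.

Lemma den_drop a b v :
  den (TDrop a b) v = unlist (drop (size (tolist (den b v))) (tolist (den a v))).
Proof. exact: iter_tl. Qed.

Lemma is_node_drop a b v :
  is_node (den (TDrop a b) v) = (size (tolist (den b v)) < size (tolist (den a v))).
Proof.
rewrite den_drop -subn_gt0 -size_drop; by case: (drop _ _).
Qed.

Lemma hd_drop_enc (T : Type) (e : T -> tree) x0 s k : k < size s ->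
  hd (unlist (drop k [seq e x | x <- s])) = e (nth x0 s k).
Proof. by move=> ks; rewrite -map_drop (drop_nth x0). Qed.

Lemma den_eq (T : eqType) (e : T -> tree) a b v x y : injective e ->
  den a v = e x -> den b v = e y -> den (TEq a b) v = enc_bool (x == y).
Proof. by move=> ie /= -> ->; rewrite /eqf /= (inj_eq ie). Qed.

Lemma den_tails (T : Type) (e : T -> tree) a v s :
  den a v = enc_seq e s -> den (TTails a) v = enc_seq (enc_seq e) (rsuf s).
Proof.
move=> /= ->; rewrite /tailsf tolist_enc enc_seqE; congr unlist.
by elim: s => //= x s IH; rewrite !map_rcons IH /= -enc_seqE.
Qed.

Lemma rsufE (T : Type) (s : seq T) :
  rsuf s = [seq drop (c : 'I_(size s)) s | c <- rev (enum 'I_(size s))].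
Proof.
transitivity [seq drop c s | c <- rev (iota 0 (size s))]; last first.
  by rewrite -val_enum_ord -map_rev -map_comp.
elim: s => //= x s ->; rewrite rev_cons map_rcons drop0; congr rcons.
by rewrite (iotaDl 1 0) -map_rev -map_comp.
Qed.

Fixpoint bvs (g : nat) : seq (g.-tuple bool) :=
  if g is g'.+1 then
    flatten [seq [:: [tuple of false :: a]; [tuple of true :: a]] | a : g'.-tuple bool <- bvs g']
  else [:: [tuple]].

Lemma mem_bvs g a : a \in bvs g.
Proof.
elim: g a => [|g IH] a; first by rewrite [a]tuple0 inE.
case/tupleP: a => b a /=; apply/flattenP.
exists [:: [tuple of false :: a]; [tuple of true :: a]].
  by apply/mapP; exists a.
by case: b; rewrite !inE eqxx ?orbT.
Qed.

Lemma size_bvs g : size (bvs g) = 2 ^ g.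
Proof.
elim: g => //= g IH; rewrite expnS -IH; elim: (bvs g) => //= a s ->; lia.
Qed.

Definition ebits (g : nat) (a : g.-tuple bool) : tree := enc_seq enc_bool a.

Lemma ebits_inj g : injective (@ebits g).
Proof. by move=> a b /(enc_seq_inj enc_bool_inj)/val_inj. Qed.

Lemma flatten_flatten (T : Type) (s : seq (seq (seq T))) :
  flatten (flatten s) = flatten [seq flatten x | x <- s].
Proof. by elim: s => //= x s <-; rewrite flatten_cat. Qed.

(** * The program computing the instance *)

(* The terms below run in the environment [[:: formula; list of bit vectors]];
   [base k f] runs [f] in that environment from under [k] further binders. *)
Definition base (k : nat) (f : term) : term := call f [:: TVar k; TVar k.+1].

Definition enc_part (x : part) : tree := Node (enc_bool x.1) (enc_nat x.2).
Definition parts : seq part := [seq (s, p) | s <- [:: false; true], p <- enum 'I_3].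

Definition t_m : term := call tlen [:: TTl (TVar 0)].
(** The list of bit vectors carries both sizes: [g] is the length of its first member and [q] its
    own length. *)
Definition t_g : term := call tlen [:: THd (TVar 1)].
Definition t_q : term := call tlen [:: TVar 1].
(** Avoids division: by [ltn_nb], the block indices are those [b] with [b * (q * g) < m]. *)
Definition t_betas : term :=
  TFor (call tiota [:: base 0 t_m])
    (TIf (TDrop (base 1 t_m) (call tmul [:: TVar 0; call tmul [:: base 1 t_q; base 1 t_g]]))
       (single (TVar 0)) TLeaf).
Definition t_blocks : term :=
  TFor (quote (enc_seq enc_part parts))
    (TFor (base 1 t_betas) (single (TNode (TVar 1) (TVar 0)))).
Definition t_locs : term :=
  TFor (base 0 t_betas) (TFor (TVar 2) (TFor (call tiota [:: base 2 t_g])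
    (single (TNode (TNode (TVar 2) (TVar 1)) (TVar 0))))).

(** The current clause is given by a suffix of the formula. Dropping as many clauses as the suffix
    has leaves a list whose length is the index of the clause. *)
Definition t_loc : term := THd (TDrop (base 1 t_locs) (TDrop (TTl (TVar 1)) (TVar 0))).
Definition t_lit (p : nat) : term := THd (iter p TTl (THd (TVar 0))).
Definition t_occ (p : nat) : term := TNode (quote (enc_nat p)) (TNode t_loc (t_lit p)).
Definition t_elit (p : nat) : term :=
  TNode (TNode (TNode TLeaf (quote (enc_nat p))) t_loc) (THd (t_lit p)).
Definition t_occs : term :=
  TFor (TTails (TTl (TVar 0))) (args [:: t_occ 0; t_occ 1; t_occ 2]).
Definition t_clauses : term :=
  TFor (TTails (TTl (TVar 0))) (single (args [:: t_elit 0; t_elit 1; t_elit 2])).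
Definition t_eqc : term :=
  args [:: args [:: TNode (TVar 0) ttrue; TNode (TVar 1) TLeaf];
           args [:: TNode (TVar 0) TLeaf; TNode (TVar 1) ttrue]].
Definition t_copy (s : bool) (o : term) : term :=
  TNode (TNode (quote (enc_bool s)) (THd o)) (THd (TTl o)).
Definition t_copies : term :=
  TFor (base 0 t_occs) (call t_eqc [:: t_copy false (TVar 0); t_copy true (TVar 0)]).
Definition t_links : term :=
  TFor (call tiota [:: THd (TVar 0)])
    (TFor (TTails (TFor (base 1 t_occs)
             (TIf (TEq (TTl (TTl (TTl (TVar 0)))) (TVar 1)) (single (TVar 0)) TLeaf)))
       (TIf (TTl (TVar 0))
          (call t_eqc [:: t_copy true (THd (TVar 0)); t_copy false (THd (TTl (TVar 0)))])
          TLeaf)).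
Definition t_cons : term :=
  call tcat [:: base 0 t_clauses; call tcat [:: base 0 t_copies; base 0 t_links]].

Definition t_W : term := TNode TLeaf (call tmul [:: quote (enc_nat 5); base 0 t_g]).
Definition t_U : term := call tmul [:: call tmul [:: quote (enc_nat 5); base 0 t_g]; base 0 t_q].
Definition t_D : term := TNode TLeaf
  (call tcat [:: base 0 t_q; call tcat [:: call tmul [:: base 0 t_q; base 0 t_W]; base 0 t_U]]).
Definition t_L : term := call tmul [:: quote (enc_nat 3); base 0 t_D].
Definition t_C : term := call tmul [:: quote (enc_nat 4); base 0 t_D].

Definition t_svs : term := call tcat
  [:: TFor (base 0 t_blocks) (TFor (TVar 2) (single (TNode TLeaf (TNode (TVar 1) (TVar 0)))));
      TFor (base 0 t_blocks) (TFor (TVar 2) (single (TNode ttrue (TNode (TVar 1) (TVar 0)))))].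

Definition t_pends : term :=
  TFor (base 0 t_blocks) (TFor (TVar 2) (TFor (base 2 t_L)
    (single (single (TNode ttrue (TNode (TVar 2) (TVar 1))))))).
Definition t_xs : term :=
  TFor (base 0 t_blocks) (TFor (TVar 2) (TFor (TVar 3) (TFor (base 3 t_W)
    (single (args [:: TNode TLeaf (TNode (TVar 3) (TVar 2));
                      TNode ttrue (TNode (TVar 3) (TVar 1))]))))).
Definition t_blk (k : nat) : term :=
  TNode (THd (THd (TVar k))) (THd (THd (TTl (THd (TVar k))))).
Definition t_us : term :=
  TFor (base 0 t_cons) (single (TFor (TVar 0)
    (TNode (TNode TLeaf (TNode (t_blk 0) (TTl (THd (TTl (THd (TVar 0)))))))
      (TFor (TVar 3)
        (TIf (TEq (THd (TDrop (TVar 0) (TTl (TTl (THd (TVar 1)))))) (TTl (TVar 1)))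
           (single (TNode ttrue (TNode (t_blk 1) (TVar 0)))) TLeaf))))).
Definition t_ivs : term :=
  call tcat [:: call tcat [:: base 0 t_pends; base 0 t_xs]; base 0 t_us].

Definition t_inc : term :=
  TIf (TFor (TVar 1) (TIf (TEq (TVar 0) (TVar 1)) unit_list TLeaf)) ttrue TLeaf.
Definition t_mat : term := call tcat
  [:: TFor (base 0 t_svs) (single (call tcat
         [:: TFor (base 1 t_svs) (single TLeaf);
             TFor (base 1 t_ivs) (single (call t_inc [:: TVar 1; TVar 0]))]));
      TFor (base 0 t_ivs) (single (call tcat
         [:: TFor (base 1 t_svs) (single (call t_inc [:: TVar 0; TVar 1]));
             TFor (base 1 t_ivs) (single TLeaf)]))].
(** Each independent vertex contributes one unit, each constraint one more and each group [W] more,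
    so the target is a sum of list lengths. It is doubled because [t_count] counts ordered pairs. *)
Definition t_target2 : term := call tmul [:: quote (enc_nat 2);
  call tcat [:: base 0 t_ivs; call tcat [:: base 0 t_cons;
    call tmul [:: call tmul [:: base 0 t_blocks; TVar 1]; base 0 t_W]]]].
Definition t_stage1 : term := TNode (TNode (base 0 t_mat) (base 0 t_C)) (base 0 t_target2).

Section Denotation.

Variables (n : nat) (phi : cnf3 n) (g : nat).
Hypothesis g_gt0 : 0 < g.
Local Notation m := (size phi).
Local Notation bits := (g.-tuple bool).

(* Clause [c] gets the [c]-th place of [locs], a list of [nb] blocks of [2 ^ g]
   groups of [g] places each; [nb] is the ceiling of [m / block_copies]. *)
Definition block_copies : nat := 2 ^ g * g.
Definition nb : nat := (m + block_copies.-1) %/ block_copies.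

Lemma block_copies_gt0 : 0 < block_copies. Proof. by rewrite muln_gt0 expn_gt0. Qed.

Lemma ltn_nb b : (b < nb) = (b * block_copies < m).
Proof.
have r0 := block_copies_gt0; rewrite /nb leq_divRL // mulSn.
by move: (b * block_copies) => k; lia.
Qed.

Lemma nb_le : nb <= m.
Proof.
rewrite leqNgt; apply/negP; rewrite ltn_nb; apply/negP; rewrite -leqNgt leq_pmulr //.
exact: block_copies_gt0.
Qed.

Lemma leq_nb : m <= nb * block_copies.
Proof. by rewrite leqNgt -ltn_nb ltnn. Qed.

Lemma nb_lt : nb * block_copies < m + block_copies.
Proof.
have := leq_divM (m + block_copies.-1) block_copies; rewrite -/nb; have := block_copies_gt0; lia.
Qed.

Definition locs : seq ('I_nb * bits * 'I_g) :=
  flatten [seq [seq (b, j, i) | j <- bvs g, i <- enum 'I_g] | b <- enum 'I_nb].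

Lemma size_locs : size locs = nb * block_copies.
Proof.
rewrite size_flatten /shape -map_comp sumnE big_map /=.
under eq_bigr do rewrite size_allpairs size_bvs size_enum_ord.
by rewrite big_enum /= sum_nat_const card_ord.
Qed.

Lemma m_locs : m <= size locs. Proof. by rewrite size_locs leq_nb. Qed.

Definition loc (c : 'I_m) : 'I_nb * bits * 'I_g := tnth (in_tuple locs) (widen_ord m_locs c).

Lemma mem_locs x : x \in locs.
Proof.
case: x => [[b j] i]; apply/flattenP; exists [seq (b, j, i) | j <- bvs g, i <- enum 'I_g].
  by apply: map_f; rewrite mem_enum.
by apply/allpairsP; exists (j, i); rewrite mem_bvs mem_enum.
Qed.

(** By counting: a list that contains every element and is no longer than the type has no
    repetition. *)
Lemma uniq_locs : uniq locs.
Proof.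
apply: (@leq_size_uniq _ (enum {: 'I_nb * bits * 'I_g})); first exact: enum_uniq.
  by move=> x _; apply: mem_locs.
by rewrite size_locs -cardE !card_prod !card_ord card_tuple card_bool -mulnA.
Qed.

Lemma loc_inj : injective loc.
Proof.
move=> c c' e; apply: val_inj.
have /tuple_uniqP inj : uniq (in_tuple locs) := uniq_locs.
exact: (congr1 val (inj _ _ e)).
Qed.

Local Notation enc_ord := (fun i => enc_nat (nat_of_ord i)).
Local Notation env0 := (Node (enc_cnf3 phi) (Node (enc_seq (@ebits g) (bvs g)) Leaf)).

Definition enc_block (b : block nb) : tree := Node (enc_part b.1) (enc_nat b.2).
Definition enc_loc (x : 'I_nb * bits * 'I_g) : tree :=
  Node (Node (enc_nat x.1.1) (ebits x.1.2)) (enc_nat x.2).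
Definition enc_occ (o : occ phi) : tree :=
  Node (enc_nat o.1) (Node (enc_loc (loc o.2)) (enc_literal (occ_lit o))).
Definition enc_copy (x : copy phi) : tree := Node (enc_part x.1) (enc_loc (loc x.2)).
Definition enc_elit (l : elit phi) : tree := Node (enc_copy l.1) (enc_bool l.2).

Lemma enc_ord_seq k (s : seq 'I_k) : enc_seq enc_ord s = enc_seq enc_nat [seq val i | i <- s].
Proof. by rewrite !enc_seqE -map_comp. Qed.

Lemma den_m : den t_m env0 = enc_nat m.
Proof. by rewrite /t_m den_len /= size_tolist_enc. Qed.

Lemma den_g : den t_g env0 = enc_nat g.
Proof.
rewrite /t_g den_len /=; have := size_bvs g; case: (bvs g) => [|a s] /=.
  by have := expn_gt0 2 g => /= + e; rewrite -e.
by rewrite size_tolist_enc size_tuple.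
Qed.

Lemma den_q : den t_q env0 = enc_nat (2 ^ g).
Proof. by rewrite /t_q den_len /= size_tolist_enc size_bvs. Qed.

Opaque t_m t_g t_q.

Lemma den_betas : den t_betas env0 = enc_seq enc_ord (enum 'I_nb).
Proof.
rewrite enc_ord_seq val_enum_ord /t_betas.
rewrite (den_filter (e := enc_nat) (s := iota 0 m) (P := fun b => b < nb)).
- congr enc_seq; rewrite -{1}(subnKC nb_le) iotaD filter_cat add0n.
  rewrite (@all_filterP _ _ (iota 0 nb) _); last by apply/allP => b; rewrite mem_iota.
  rewrite (@eq_in_filter _ _ pred0) ?filter_pred0 ?cats0 // => b; rewrite mem_iota => /andP[h _].
  by rewrite /= ltnNge h.
- by apply: den_iota; apply: den_m.
- move=> b; rewrite is_node_drop -/(base 1 t_m) ltn_nb.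
  rewrite (den_mul_nat (j := b) (k := block_copies)) //; last first.
    by apply: den_mul_nat; [apply: den_q|apply: den_g].
  by rewrite [den (base 1 t_m) _]den_m !size_enc_nat.
Qed.

Opaque t_betas.

Definition blocks : seq (block nb) := [seq (pt, b) | pt <- parts, b <- enum 'I_nb].

Lemma den_blocks : den t_blocks env0 = enc_seq enc_block blocks.
Proof.
apply: den_for; first exact: den_quote.
by move=> pt; apply: den_map; first exact: den_betas.
Qed.

Lemma den_locs : den t_locs env0 = enc_seq enc_loc locs.
Proof.
apply: den_for; first exact: den_betas.
move=> b; apply: den_for; first by [].
move=> j; apply: (den_map (ea := enc_ord)) => //.
rewrite enc_ord_seq val_enum_ord; apply: den_iota; exact: den_g.
Qed.

Opaque t_blocks t_locs.

Lemma den_args l v : den (args l) v = unlist [seq den x v | x <- l].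
Proof. by elim: l => //= x l ->. Qed.

Lemma den_args3 (T : Type) (e : T -> tree) (F : nat -> term) (G : 'I_3 -> T) v :
  (forall p : 'I_3, den (F p) v = e (G p)) ->
  den (args [:: F 0; F 1; F 2]) v = enc_seq e [seq G p | p <- enum 'I_3].
Proof.
move=> FG; rewrite -[[:: _; _; _]]/[seq F k | k <- iota 0 3] den_args enc_seqE -val_enum_ord.
by rewrite -!map_comp; congr unlist; apply: eq_map => p /=.
Qed.

Local Notation enc_cl := (enc_seq (@enc_literal n)).
Definition enc_suffix (c : 'I_m) : tree := enc_seq (fun x : clause n => enc_cl x) (drop c phi).

Lemma den_suffixes : den (TTails (TTl (TVar 0))) env0 = enc_seq enc_suffix (rev (enum 'I_m)).
Proof.
rewrite (den_tails (e := fun x : clause n => enc_cl x) (s := phi)) // rsufE !enc_seqE -map_comp.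
by [].
Qed.

Lemma den_loc c : den t_loc (Node (enc_suffix c) env0) = enc_loc (loc c).
Proof.
rewrite /t_loc.
rewrite -[den (THd _) _]/(hd (den (TDrop (base 1 t_locs) (TDrop (TTl (TVar 1)) (TVar 0)))
  (Node (enc_suffix c) env0))).
rewrite den_drop den_drop unlistK size_drop /=.
rewrite [den t_locs _]den_locs !size_tolist_enc tolist_enc size_drop subKn; last exact: ltnW.
rewrite (hd_drop_enc _ (loc c)); last exact: leq_trans (ltn_ord c) m_locs.
by congr enc_loc; apply/esym/tnth_nth.
Qed.

Lemma den_lit c (p : 'I_3) :
  den (t_lit p) (Node (enc_suffix c) env0) = enc_literal (occ_lit (p, c)).
Proof.
have itE k a v : den (iter k TTl a) v = iter k tl (den a v) by elim: k => //= k ->.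
rewrite /t_lit -[den (THd _) _]/(hd (den (iter p TTl (THd (TVar 0))) (Node (enc_suffix c) env0))).
rewrite itE iter_tl /= /enc_suffix (drop_nth (tnth (in_tuple phi) c)) //= tolist_enc.
rewrite (hd_drop_enc _ (occ_lit (p, c))) ?size_tuple //; congr enc_literal.
have ec : nth (tnth (in_tuple phi) c) phi c = tnth (in_tuple phi) c by apply/esym/tnth_nth.
by rewrite ec; apply/esym/tnth_nth.
Qed.

Opaque t_loc t_lit.

Lemma den_occs : den t_occs env0 = enc_seq enc_occ (occs phi).
Proof.
apply: den_for; first exact: den_suffixes.
move=> c; apply: (den_args3 (F := t_occ)) => p.
by rewrite /= den_quote den_loc den_lit.
Qed.

Lemma den_clauses : den t_clauses env0 = enc_seq (enc_seq enc_elit) (clause_constraints phi).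
Proof.
apply: den_map; first exact: den_suffixes.
move=> c; apply: (den_args3 (F := t_elit)) => p.
by rewrite /= den_quote den_loc den_lit.
Qed.

Opaque t_occs t_clauses.

Lemma den_eqc a b v x y : den a v = enc_copy x -> den b v = enc_copy y ->
  den (call t_eqc [:: a; b]) v = enc_seq (enc_seq enc_elit) (eq_constraints x y).
Proof. by move=> /= -> ->. Qed.

Lemma den_copy s a v o : den a v = enc_occ o -> den (t_copy s a) v = enc_copy (copy_of s o).
Proof. by move=> /= ->; rewrite den_quote. Qed.

Opaque t_eqc t_copy.

Lemma den_copies : den t_copies env0 = enc_seq (enc_seq enc_elit) (copy_constraints phi).
Proof.
apply: den_for; first exact: den_occs.
by move=> o; apply: den_eqc; apply: den_copy.
Qed.

Lemma den_links : den t_links env0 = enc_seq (enc_seq enc_elit) (link_constraints phi).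
Proof.
pose lnk (t : seq (occ phi)) : seq (seq (elit phi)) :=
  if t is x :: y :: _ then eq_constraints (copy_of true x) (copy_of false y) else [::].
have -> : link_constraints phi =
    flatten [seq flatten [seq lnk t | t <- rsuf [seq o <- occs phi | (occ_lit o).2 == z]]
      | z <- enum 'I_n].
  rewrite /link_constraints /links map_flatten -map_comp flatten_flatten -map_comp.
  congr flatten; apply: eq_map => z /=; rewrite /consec.
  rewrite map_flatten -map_comp flatten_flatten -map_comp; congr flatten; apply: eq_map => t /=.
  by case: t => [|x [|y t]] //=.
apply: (den_for (ea := enc_ord)).
  by rewrite enc_ord_seq val_enum_ord; apply: den_iota.
move=> z; apply: den_for.
  apply: den_tails; apply: den_filter; first exact: den_occs.
  move=> o; rewrite (den_eq (e := enc_nat) (x := (occ_lit o).2) (y := z)) //; last exact: enc_nat_inj.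
  by rewrite -val_eqE; case: (_ == _).
by case=> [|x [|y t]].
Qed.

Opaque t_copies t_links.

Lemma den_cons : den t_cons env0 = enc_seq (enc_seq enc_elit) (constraints phi).
Proof.
apply: den_cat_seq; first exact: den_clauses.
by apply: den_cat_seq; [apply: den_copies|apply: den_links].
Qed.

Lemma den_W : den t_W env0 = enc_nat (gW g).
Proof.
rewrite -[LHS]/(Node Leaf (den (call tmul [:: quote (enc_nat 5); base 0 t_g]) env0)).
rewrite (den_mul_nat (j := 5) (k := g)) //; exact: den_g.
Qed.

Lemma den_U : den t_U env0 = enc_nat (gU g).
Proof.
apply: den_mul_nat; last exact: den_q.
by apply: den_mul_nat => //; apply: den_g.
Qed.

Opaque t_W t_U.

Lemma den_D : den t_D env0 = enc_nat (gD g).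
Proof.
rewrite -[LHS]/(Node Leaf (den (call tcat [:: base 0 t_q; call tcat [::
  call tmul [:: base 0 t_q; base 0 t_W]; base 0 t_U]]) env0)).
rewrite (den_cat_nat (j := 2 ^ g) (k := 2 ^ g * gW g + gU g)) //; first exact: den_q.
apply: den_cat_nat; last exact: den_U.
by apply: den_mul_nat; [apply: den_q|apply: den_W].
Qed.

Opaque t_cons t_D.

Lemma den_L : den t_L env0 = enc_nat (gL g).
Proof. by apply: den_mul_nat => //; apply: den_D. Qed.

Lemma den_C : den t_C env0 = enc_nat (gC g).
Proof. by apply: den_mul_nat => //; apply: den_D. Qed.

Opaque t_L t_C.

Local Notation sv := (svert (block nb) bits bits).
Local Notation nc := (size (constraints phi)).
Local Notation iv := (ivert (block nb) bits bits 'I_nc (gL g) (gW g)).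

Definition enc_sv (x : sv) : tree :=
  match x with
  | inl v => Node Leaf (Node (enc_block v.1) (ebits v.2))
  | inr b => Node (Node Leaf Leaf) (Node (enc_block b.1) (ebits b.2))
  end.

Lemma enc_sv_inj : injective enc_sv.
Proof.
have blk : injective enc_block.
  by move=> [[s p] b] [[s' p'] b'] [/enc_bool_inj-> /enc_nat_inj/val_inj-> /enc_nat_inj/val_inj->].
by move=> [[b j]|[b j]] [[b' j']|[b' j']] // /(congr1 tl) e;
  move: (blk _ _ (congr1 hd e)) (ebits_inj (congr1 tl e)) => /= -> ->.
Qed.

Definition inbrs (u : iv) : seq sv :=
  match u with
  | inl (inl p) => [:: inr p.1]
  | inl (inr p) => [:: inl p.1.1; inr (p.1.1.1, p.1.2)]
  | inr k => cnbrs loc (bvs g) (tnth (in_tuple (constraints phi)) k)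
  end.

Local Notation ginc :=
  (@inc (block nb) bits bits 'I_nc (gL g) (gW g) (cadj loc (bvs g))).

Lemma incE x u : ginc x u = (x \in inbrs u).
Proof. by case: u => [[p|p]|k] //=; rewrite !inE. Qed.

(** An independent vertex is its list of neighbours, so incidence becomes a membership test.
    Pendants of one anchor get equal codes and are told apart only by their place in the list
    [ivs]. *)
Definition enc_iv (u : iv) : tree := enc_seq enc_sv (inbrs u).

Definition svs : seq sv :=
  [seq inl (b, j) | b <- blocks, j <- bvs g] ++ [seq inr (b, a) | b <- blocks, a <- bvs g].
Definition pends : seq iv :=
  flatten [seq [seq inl (inl ((b, a), w)) | a <- bvs g, w <- enum 'I_(gL g)] | b <- blocks].
Definition xs : seq iv :=
  flatten [seq flatten [seq [seq inl (inr ((b, j), a, w)) | a <- bvs g, w <- enum 'I_(gW g)]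
    | j <- bvs g] | b <- blocks].
Definition us : seq iv := [seq inr k | k <- enum 'I_nc].
Definition ivs : seq iv := (pends ++ xs) ++ us.
Definition vs : seq (sv + iv) := [seq inl x | x <- svs] ++ [seq inr u | u <- ivs].

Lemma den_svs : den t_svs env0 = enc_seq enc_sv svs.
Proof.
apply: den_cat_seq; apply: den_for; try exact: den_blocks.
- by move=> b; apply: den_map.
- by move=> b; apply: den_map.
Qed.

(** Turns a loop over a unary number into one over ordinals, as needed for the multiplicities [L]
    and [W]. *)
Lemma enc_nat_ord k : enc_nat k = enc_seq (fun _ : 'I_k => Leaf) (enum 'I_k).
Proof.
rewrite enc_nat_nseq enc_seqE -{1}(size_enum_ord k); congr unlist.
by elim: (enum _) => //= _ s <-.
Qed.

Lemma den_pends : den t_pends env0 = enc_seq enc_iv pends.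
Proof.
apply: den_for; first exact: den_blocks.
move=> b; apply: den_for; first by [].
move=> a; apply: (den_map (ea := fun _ => Leaf)) => //.
by rewrite -enc_nat_ord; apply: den_L.
Qed.

Lemma den_xs : den t_xs env0 = enc_seq enc_iv xs.
Proof.
apply: den_for; first exact: den_blocks.
move=> b; apply: den_for; first by [].
move=> j; apply: den_for; first by [].
move=> a; apply: (den_map (ea := fun _ => Leaf)) => //.
by rewrite -enc_nat_ord; apply: den_W.
Qed.

Lemma den_us : den t_us env0 = enc_seq enc_iv us.
Proof.
apply: (den_map (ea := fun k => enc_seq enc_elit (tnth (in_tuple (constraints phi)) k))).
  rewrite [LHS]den_cons !enc_seqE -[constraints phi in LHS]/(tval (in_tuple (constraints phi))).
  by rewrite -[in LHS](map_tnth_enum (in_tuple _)) -map_comp.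
move=> k; apply: (den_for (eb := enc_sv)) => // l.
rewrite -[LHS]/(Node (Node Leaf (Node (enc_block (l.1.1, (loc l.1.2).1.1)) (ebits (loc l.1.2).1.2)))
  (den (TFor (TVar 3)
        (TIf (TEq (THd (TDrop (TVar 0) (TTl (TTl (THd (TVar 1)))))) (TTl (TVar 1)))
           (single (TNode ttrue (TNode (t_blk 1) (TVar 0)))) TLeaf))
    (Node (enc_elit l) (Node (enc_seq enc_elit (tnth (in_tuple (constraints phi)) k)) env0)))).
rewrite (den_for (ea := @ebits g) (eb := enc_sv) (s := bvs g) (F := fun a =>
  if tnth a (loc l.1.2).2 == l.2 then [:: inr ((l.1.1, (loc l.1.2).1.1), a)] else [::])) //.
  rewrite /elit_nbrs; congr Node; congr enc_seq.
  by elim: (bvs g) => //= a s ->; case: (_ == _).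
move=> a; set env := Node (ebits a) _.
rewrite -[LHS]/(if is_node (den (TEq (THd (TDrop (TVar 0) (TTl (TTl (THd (TVar 1))))))
    (TTl (TVar 1))) env) then enc_seq enc_sv [:: inr ((l.1.1, (loc l.1.2).1.1), a)] else Leaf).
rewrite (den_eq (x := tnth a (loc l.1.2).2) (y := l.2) enc_bool_inj) //.
- by case: (_ == _).
- rewrite -[LHS]/(hd (den (TDrop (TVar 0) (TTl (TTl (THd (TVar 1))))) env)).
  rewrite den_drop /= size_enc_nat tolist_enc (hd_drop_enc _ false) ?size_tuple //.
  by rewrite (tnth_nth false).
Qed.

Opaque t_pends t_xs t_us.

Lemma den_ivs : den t_ivs env0 = enc_seq enc_iv ivs.
Proof.
apply: den_cat_seq; last exact: den_us.
by apply: den_cat_seq; [apply: den_pends|apply: den_xs].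
Qed.

Opaque t_svs t_ivs.

Lemma den_inc a b v x u : den a v = enc_sv x -> den b v = enc_iv u ->
  den (call t_inc [:: a; b]) v = enc_bool (ginc x u).
Proof.
move=> ha hb; rewrite incE.
rewrite -[LHS]/(if is_node (den (TFor (TVar 1) (TIf (TEq (TVar 0) (TVar 1)) unit_list TLeaf))
  (Node (den a v) (Node (den b v) Leaf))) then Node Leaf Leaf else Leaf) ha hb.
rewrite (den_for (ea := enc_sv) (eb := fun _ => Leaf) (s := inbrs u)
  (F := fun y => nseq (y == x) tt)) //.
  by elim: (inbrs u) => //= y s; rewrite inE eq_sym; case: (x == y) => //= <-.
move=> y; rewrite -[LHS]/(if is_node (den (TEq (TVar 0) (TVar 1))
  (Node (enc_sv y) (Node (enc_sv x) (Node (enc_iv u) Leaf)))) then Node Leaf Leaf else Leaf).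
by rewrite (den_eq (x := y) (y := x) enc_sv_inj) //; case: (_ == _).
Qed.

Opaque t_inc.

Lemma enc_seq_vs (e : sv + iv -> tree) : enc_seq e vs =
  unlist (tolist (enc_seq (fun x => e (inl x)) svs) ++ tolist (enc_seq (fun u => e (inr u)) ivs)).
Proof. by rewrite !tolist_enc enc_seqE map_cat -!map_comp. Qed.

Lemma den_mat : den t_mat env0 =
  enc_seq (fun x => enc_seq (fun y => enc_bool (inc_adj ginc x y)) vs) vs.
Proof.
rewrite /t_mat den_cat enc_seq_vs; congr (unlist (tolist _ ++ tolist _)).
  rewrite -[svs]map_id; apply: den_map; first exact: den_svs.
  move=> x; rewrite den_cat enc_seq_vs; congr (unlist (tolist _ ++ tolist _)).
    by rewrite -[svs]map_id; apply: den_map; first exact: den_svs.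
  rewrite -[ivs]map_id; apply: den_map; first exact: den_ivs.
  by move=> u; apply: den_inc.
rewrite -[ivs]map_id; apply: den_map; first exact: den_ivs.
move=> u; rewrite den_cat enc_seq_vs; congr (unlist (tolist _ ++ tolist _)).
  rewrite -[svs]map_id; apply: den_map; first exact: den_svs.
  by move=> x; apply: den_inc.
by rewrite -[ivs]map_id; apply: den_map; first exact: den_ivs.
Qed.
Opaque t_mat.

End Denotation.

Lemma size_flatten_map (T T' : Type) (F : T -> seq T') s :
  size (flatten [seq F x | x <- s]) = \sum_(x <- s) size (F x).
Proof. by rewrite size_flatten /shape -map_comp sumnE big_map. Qed.

(** * Size, correctness and cover number of the produced instance *)

Section Instance.

Variables (n : nat) (phi : cnf3 n) (g : nat).
Hypothesis g_gt0 : 0 < g.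
Local Notation m := (size phi).
Local Notation bits := (g.-tuple bool).
Local Notation nbb := (nb phi g).
Local Notation sv := (svert (block nbb) bits bits).
Local Notation nc := (size (constraints phi)).
Local Notation iv := (ivert (block nbb) bits bits 'I_nc (gL g) (gW g)).
Local Notation blks := (blocks phi g).
Local Notation ginc :=
  (@inc (block nbb) bits bits 'I_nc (gL g) (gW g) (cadj (loc g_gt0) (bvs g))).
Local Notation gtarget := (target (block nbb) bits bits 'I_nc (gL g) (gW g)).

Lemma size_parts : size parts = 6.
Proof. by rewrite size_allpairs size_enum_ord. Qed.

Lemma size_blocks : size blks = 6 * nbb.
Proof. by rewrite size_allpairs size_parts size_enum_ord. Qed.

Lemma mem_blocks b : b \in blks.
Proof.
case: b => [[s p] i]; apply/allpairsP; exists ((s, p), i); split=> //=; last by rewrite mem_enum.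
by apply/allpairsP; exists (s, p); split=> //=; [case: s|rewrite mem_enum].
Qed.

Lemma size_svs : size (svs phi g) = 2 * (6 * nbb * 2 ^ g).
Proof. by rewrite size_cat !(size_allpairs _ blks) size_blocks size_bvs mul2n addnn. Qed.

Lemma sum_const_seq (T : Type) (s : seq T) k : \sum_(x <- s) k = size s * k.
Proof. by elim: s => [|x s IH]; rewrite ?big_nil // big_cons IH. Qed.

Lemma size_pends : size (pends phi g) = 6 * nbb * 2 ^ g * gL g.
Proof.
rewrite size_flatten_map; under eq_bigr do rewrite size_allpairs size_bvs size_enum_ord.
by rewrite sum_const_seq size_blocks mulnA.
Qed.

Lemma size_xs : size (xs phi g) = 6 * nbb * 2 ^ g * 2 ^ g * gW g.
Proof.
rewrite size_flatten_map.
under eq_bigr do rewrite size_flatten_map.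
under eq_bigr do under eq_bigr do rewrite size_allpairs size_bvs size_enum_ord.
by under eq_bigr do rewrite sum_const_seq size_bvs; rewrite sum_const_seq size_blocks !mulnA.
Qed.

Lemma size_us : size (us phi g) = nc.
Proof. by rewrite size_map size_enum_ord. Qed.

Lemma mem_vs x : x \in vs phi g.
Proof.
rewrite mem_cat; case: x => [[[b j]|[b a]]|u].
- rewrite map_f // mem_cat; apply/orP; left; apply/allpairsP.
  by exists (b, j); rewrite mem_blocks mem_bvs.
- rewrite map_f // mem_cat; apply/orP; right; apply/allpairsP.
  by exists (b, a); rewrite mem_blocks mem_bvs.
apply/orP; right; apply: map_f; rewrite !mem_cat.
case: u => [[[[b a] w]|[[[b j] a] w]]|k].
- apply/orP; left; apply/orP; left; apply/flattenP.
  exists [seq inl (inl ((b, a), w)) | a <- bvs g, w <- enum 'I_(gL g)].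
    by apply/mapP; exists b; rewrite ?mem_blocks.
  by apply/allpairsP; exists (a, w); rewrite mem_bvs mem_enum.
- apply/orP; left; apply/orP; right; apply/flattenP.
  exists (flatten [seq [seq inl (inr ((b, j), a, w)) | a <- bvs g, w <- enum 'I_(gW g)]
    | j <- bvs g]).
    by apply/mapP; exists b; rewrite ?mem_blocks.
  apply/flattenP; exists [seq inl (inr ((b, j), a, w)) | a <- bvs g, w <- enum 'I_(gW g)].
    by apply/mapP; exists j; rewrite ?mem_bvs.
  by apply/allpairsP; exists (a, w); rewrite mem_bvs mem_enum.
- by apply/orP; right; apply: map_f; rewrite mem_enum.
Qed.

Lemma size_ivs : size (ivs phi g) = 6 * nbb * 2 ^ g * gL g + 6 * nbb * 2 ^ g * 2 ^ g * gW g + nc.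
Proof. by rewrite /ivs !size_cat size_pends size_xs size_us. Qed.

Lemma uniq_vs : uniq (vs phi g).
Proof.
apply: (@leq_size_uniq _ (enum {: sv + iv})); first exact: enum_uniq.
  by move=> x _; apply: mem_vs.
rewrite -cardE /vs size_cat !size_map size_svs size_ivs !card_sum !card_prod.
by rewrite !card_ord card_tuple card_bool mul2n addnn.
Qed.

Lemma card_svert : #|{: sv}| = 2 * (6 * nbb * 2 ^ g).
Proof. by rewrite card_sum !card_prod !card_ord card_tuple card_bool [RHS]mul2n addnn. Qed.

Definition red_graph : graph := inc_graph ginc (vs phi g).

Local Notation env0 := (Node (enc_cnf3 phi) (Node (enc_seq (@ebits g) (bvs g)) Leaf)).

Lemma den_target2 : den t_target2 env0 = enc_nat (2 * gtarget).
Proof.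
have size_cat_den a b v : size (tolist (den (call tcat [:: a; b]) v)) =
    size (tolist (den a v)) + size (tolist (den b v)).
  by rewrite den_cat unlistK size_cat.
have size_mul_den a b v : size (tolist (den (call tmul [:: a; b]) v)) =
    size (tolist (den a v)) * size (tolist (den b v)).
  by rewrite den_mul size_enc_nat.
have hI : size (tolist (den (base 0 t_ivs) env0)) = size (ivs phi g).
  by rewrite -[den _ _]/(den t_ivs env0) (den_ivs phi g_gt0) size_tolist_enc.
have hC : size (tolist (den (base 0 t_cons) env0)) = nc.
  by rewrite -[den _ _]/(den t_cons env0) (den_cons phi g_gt0) size_tolist_enc.
have hB : size (tolist (den (base 0 t_blocks) env0)) = size blks.
  by rewrite -[den _ _]/(den t_blocks env0) (den_blocks phi g_gt0) size_tolist_enc.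
have hW : size (tolist (den (base 0 t_W) env0)) = gW g.
  by rewrite -[den _ _]/(den t_W env0) (den_W phi g) size_enc_nat.
have hQ : size (tolist (den (TVar 1) env0)) = 2 ^ g.
  by rewrite -[den _ _]/(enc_seq (@ebits g) (bvs g)) size_tolist_enc size_bvs.
rewrite /t_target2 den_mul !size_cat_den !size_mul_den hI hC hB hW hQ den_quote size_enc_nat.
rewrite size_ivs size_blocks.
congr enc_nat; congr (2 * _).
rewrite /target !card_prod !card_ord card_tuple card_bool.
lia.
Qed.

Lemma den_stage1 : den t_stage1 env0 =
  Node (enc_instance red_graph (gC g)) (enc_nat (2 * gtarget)).
Proof.
rewrite -[LHS]/(Node (Node (den t_mat env0) (den t_C env0)) (den t_target2 env0)).
by rewrite (den_mat phi g_gt0) (den_C phi g) den_target2 enc_inc_graph.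
Qed.

Lemma red_graph_correct P : optimal_partition red_graph (gC g) P ->
  (2 * gtarget <= 2 * value red_graph P) = satisfiable phi.
Proof.
rewrite leq_pmul2l //; apply: reduction_correct.
- exact: loc_inj.
- exact: mem_bvs.
- exact: uniq_vs.
- exact: mem_vs.
Qed.

Lemma vc_red_graph : vc red_graph <= 12 * (nbb * 2 ^ g).
Proof.
apply: leq_trans (vc_inc_graph _ uniq_vs) _.
by rewrite card_svert; lia.
Qed.

End Instance.

(** Ordered adjacent pairs inside the output blocks, in unary. [TVar 3] is the result of the
    reduction, whose first component contains the matrix; rows and entries are found by dropping [x]
    and [y] elements. *)
Definition t_count : term :=
  TFor (TVar 1) (TFor (TVar 0) (TFor (TVar 1)
    (TIf (THd (TDrop (THd (TDrop (THd (THd (TVar 3))) (TVar 1))) (TVar 0))) unit_list TLeaf))).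
Definition t_check : term := TIf (TDrop (TTl (TVar 0)) t_count) TLeaf ttrue.

Lemma den_check (G : graph) C k out P : represents out P ->
  den t_check (Node (Node (enc_instance G C) (enc_nat k)) (Node out Leaf)) =
  enc_bool (k <= 2 * value G P).
Proof.
move=> [s [-> us s0 ->]].
set v := Node _ _.
rewrite -[LHS]/(if is_node (den (TDrop (TTl (TVar 0)) t_count) v) then Leaf else Node Leaf Leaf).
rewrite is_node_drop [den (TTl _) _]/= size_enc_nat.
rewrite (den_for (ea := enc_seq (fun x : 'I_(nverts G) => enc_nat x))
  (eb := fun _ : unit => Leaf) (s := s)
  (F := fun b => flatten [seq flatten [seq nseq (adj G x y) tt | y <- b] | x <- b])) //.
  rewrite size_tolist_enc size_flatten_map -value_seq //.
  under eq_bigr do rewrite size_flatten_map.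
  under eq_bigr do under eq_bigr do rewrite size_flatten_map.
  under eq_bigr do under eq_bigr do under eq_bigr do rewrite size_nseq.
  by rewrite ltnNge; case: leqP.
move=> b; apply: (den_for (ea := fun x : 'I_(nverts G) => enc_nat x)) => // x.
apply: (den_for (ea := fun x : 'I_(nverts G) => enc_nat x)) => // y.
set w := Node (enc_nat y) _.
rewrite -[LHS]/(if is_node (hd (den (TDrop (THd (TDrop (THd (THd (TVar 3))) (TVar 1))) (TVar 0)) w))
  then Node Leaf Leaf else Leaf).
rewrite den_drop.
rewrite -[den (THd (TDrop _ _)) w]/(hd (den (TDrop (THd (THd (TVar 3))) (TVar 1)) w)) den_drop.
rewrite /= !size_enc_nat tolist_enc (hd_drop_enc _ x) ?size_enum_ord // nth_ord_enum.
rewrite tolist_enc (hd_drop_enc _ y) ?size_enum_ord // nth_ord_enum.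
by case: (adj G x y).
Qed.

(* [gsz m] is about a third of the binary logarithm of [m], but at least 1. *)
Definition gstep (m g : nat) : nat := if (2 ^ g.+1) ^ 3 <= m then g.+1 else g.
Definition gsz (m : nat) : nat := iter m (gstep m) 1.

(** The summand 8 is the cube for the initial size 1. For the last bound, each round either
    increases the size or has reached the bound for good; if every round increases it, the size
    exceeds [m], which suffices. *)
Lemma gsz_bounds m : [/\ 0 < gsz m, (2 ^ gsz m) ^ 3 <= 8 + m & m < (2 ^ (gsz m).+1) ^ 3].
Proof.
have inv k : 0 < iter k (gstep m) 1 /\ (2 ^ iter k (gstep m) 1) ^ 3 <= 8 + m.
  elim: k => [|k [h1 h2]]; first by split => //; rewrite leq_addr.
  by rewrite /= /gstep; case: ifP => // h3; split=> //; apply: leq_trans h3 (leq_addl _ _).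
have [h1 h2] := inv m; split=> //.
have prog k : k < iter k (gstep m) 1 \/ m < (2 ^ (iter k (gstep m) 1).+1) ^ 3.
  elim: k => [|k]; first by left.
  rewrite iterS; move: (iter k (gstep m) 1) => x IH.
  have [lt|le] := ltnP m ((2 ^ x.+1) ^ 3).
    by right; have -> : gstep m x = x by rewrite /gstep leqNgt lt.
  by case: IH => [h|]; [left; rewrite /gstep le ltnS|rewrite ltnNge le].
case: (prog m) => // h; rewrite -/(gsz m) in h.
apply: leq_trans (ltn_expl m (isT : 1 < 2)) _; rewrite -expnM leq_exp2l //.
by apply: leq_trans (ltnW h) _; lia.
Qed.

Definition t_dbl : term := TFor (TVar 1) (args [:: TNode TLeaf (TVar 0); TNode ttrue (TVar 0)]).
(** [t_dbl] lists the bit vectors with one more bit, so its length is the next candidate for [q]; it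
    is kept unless its cube exceeds [m]. *)
Definition t_step : term :=
  TNode (TTl (TVar 0)) (TNode
    (TIf (TDrop (call tmul [:: t_dbl; call tmul [:: t_dbl; t_dbl]]) (TVar 2)) (TVar 1) t_dbl)
    (TNode (TVar 2) TLeaf)).
Definition t_init : term :=
  TNode (call tlen [:: TTl (TVar 0)]) (TNode (quote (enc_seq (@ebits 1) (bvs 1)))
    (TNode (call tlen [:: TTl (TVar 0)]) TLeaf)).

Definition bv_state (k g m : nat) : tree :=
  Node (enc_nat k) (Node (enc_seq (@ebits g) (bvs g)) (Node (enc_nat m) Leaf)).

Lemma den_step k g m : den t_step (bv_state k g m) = bv_state k.-1 (gstep m g) m.
Proof.
have dbl : den t_dbl (bv_state k g m) = enc_seq (@ebits g.+1) (bvs g.+1) by apply: den_for.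
rewrite -[LHS]/(Node (tl (enc_nat k)) (Node
  (if is_node (den (TDrop (call tmul [:: t_dbl; call tmul [:: t_dbl; t_dbl]]) (TVar 2))
      (bv_state k g m))
   then enc_seq (@ebits g) (bvs g) else den t_dbl (bv_state k g m)) (Node (enc_nat m) Leaf))).
rewrite is_node_drop !den_mul !size_enc_nat dbl !size_tolist_enc !size_bvs.
rewrite /bv_state /gstep.
have -> : 2 ^ g.+1 * (2 ^ g.+1 * 2 ^ g.+1) = (2 ^ g.+1) ^ 3 by rewrite (expnS _ 2) (expnS _ 1) expn1.
by rewrite ltnNge; case: leqP; case: (k).
Qed.

Definition bv_loop (v : tree) : tree :=
  let s := den t_init (Node v Leaf) in iter (size (tolist (hd s))) (den t_step) s.

Lemma den_init v : den t_init (Node v Leaf) =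
  bv_state (size (tolist (tl v))) 1 (size (tolist (tl v))).
Proof.
rewrite -[LHS]/(Node (den (call tlen [:: TTl (TVar 0)]) (Node v Leaf))
  (Node (den (quote (enc_seq (@ebits 1) (bvs 1))) (Node v Leaf))
    (Node (den (call tlen [:: TTl (TVar 0)]) (Node v Leaf)) Leaf))).
by rewrite den_len den_quote.
Qed.

Lemma iter_step i k g m : iter i (den t_step) (bv_state k g m) =
  bv_state (k - i) (iter i (gstep m) g) m.
Proof. by elim: i => [|i IH]; rewrite ?subn0 // iterS IH den_step /= subnS. Qed.

Lemma bv_loopE v : bv_loop v = bv_state 0 (gsz (size (tolist (tl v)))) (size (tolist (tl v))).
Proof. by rewrite /bv_loop den_init iter_step /= size_enc_nat subnn. Qed.

(** * Running time *)

Lemma tree_size_enc_nat k : tree_size (enc_nat k) = k.*2.+1.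
Proof. by elim: k => //= k ->; rewrite doubleS. Qed.

Lemma tree_size_enc_seq (T : Type) (e : T -> tree) s :
  tree_size (enc_seq e s) = (\sum_(x <- s) (tree_size (e x)).+1).+1.
Proof. by rewrite enc_seqE tree_size_unlist big_map. Qed.

Lemma tree_size_enc_seq_le (T : eqType) (e : T -> tree) s B :
  (forall x, x \in s -> tree_size (e x) < B) -> tree_size (enc_seq e s) <= (size s * B).+1.
Proof.
move=> h; rewrite tree_size_enc_seq ltnS -sum_const_seq !big_seq.
by apply: leq_sum => x xs; apply: h.
Qed.

Lemma tree_size_bool b : tree_size (enc_bool b) <= 3. Proof. by case: b. Qed.

Lemma tree_size_ebits g (a : g.-tuple bool) : tree_size (ebits a) <= (g * 4).+1.
Proof.
rewrite -{2}(size_tuple a); apply: tree_size_enc_seq_le => b _; rewrite ltnS; exact: tree_size_bool.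
Qed.

Lemma gstep_inv m i : (2 ^ iter i (gstep m) 1) ^ 3 <= 8 + m.
Proof.
elim: i => [|i IH]; first by rewrite leq_addr.
rewrite iterS; move: (iter i _ _) IH => x IH; rewrite /gstep; case: ifP => // h3.
exact: leq_trans h3 (leq_addl _ _).
Qed.

Lemma tree_size_bv_state k g m X : k <= m -> m < X -> (2 ^ g) ^ 3 <= 8 + m -> 1 < X ->
  tree_size (bv_state k g m) <= X ^ 9.
Proof.
move=> km mX q3 X1; have g2 : g < 2 ^ g by apply: ltn_expl.
have q2 : 2 ^ g <= 8 + m.
  apply: leq_trans q3; rewrite -{1}(expn1 (2 ^ g)) leq_pexp2l // ?expn_gt0 //.
have bv : tree_size (enc_seq (@ebits g) (bvs g)) <= (2 ^ g * (g * 4).+2).+1.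
  rewrite -size_bvs; apply: tree_size_enc_seq_le => a _; rewrite ltnS; exact: tree_size_ebits.
apply: (@leq_trans (X ^ 2 * 2 ^ 7)); last first.
  by rewrite (expnD X 2 7) leq_mul2l leq_exp2r // X1 orbT.
rewrite /= !tree_size_enc_nat expnS expn1; move: bv; set t := tree_size _ => bv.
move: (2 ^ g) g2 q2 bv {q3} => q g2 q2 bv.
have h1 : q * (g * 4).+2 <= (8 + m) * (4 * (8 + m)) by apply: leq_mul => //; lia.
have h2 : (8 + m) * (4 * (8 + m)) <= 5 * X * (4 * (5 * X)) by apply: leq_mul; lia.
move: h1 h2 bv; move: (q * _) => z h1 h2 bv.
rewrite -!muln2; nia.
Qed.

Lemma polyf_bv_loop : polyf bv_loop.
Proof.
apply: (@polyf_loop (fun v => den t_init (Node v Leaf)) (den t_step) 9).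
- exact: (polyf_comp (polyf_node polyf_id (polyf_den TLeaf)) (polyf_den t_init)).
- exact: polyf_den.
- by [].
- move=> v i; rewrite den_init iter_step.
  apply: tree_size_bv_state; [exact: leq_subr| |exact: gstep_inv|].
    by rewrite ltnS; apply: leq_trans (size_tolist _) (leq_trans (leq_pred _) (tree_size_tl _)).
  by rewrite ltnS tree_size_gt0.
Qed.

Definition stage1 (v : tree) : tree :=
  den t_stage1 (Node v (Node (hd (tl (bv_loop v))) Leaf)).

Lemma polyf_stage1 : polyf stage1.
Proof.
apply: (@eq_polyf (den t_stage1 \o (fun v => Node v (Node (den (TVar 1) (bv_loop v)) Leaf)))).
  by [].
apply: polyf_comp (polyf_den _).
apply: polyf_node polyf_id _.
apply: polyf_node (polyf_den TLeaf).
exact: (polyf_comp polyf_bv_loop (polyf_den (TVar 1))).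
Qed.

Lemma gsz_gt0 m : 0 < gsz m. Proof. by have [] := gsz_bounds m. Qed.

Lemma stage1E n (phi : cnf3 n) :
  let g := gsz (size phi) in
  stage1 (enc_cnf3 phi) = Node (enc_instance (red_graph phi (gsz_gt0 (size phi))) (gC g))
   (enc_nat (2 * target (block (nb phi g)) (g.-tuple bool) (g.-tuple bool)
      'I_(size (constraints phi)) (gL g) (gW g))).
Proof.
rewrite /stage1 bv_loopE.
have -> : size (tolist (tl (enc_cnf3 phi))) = size phi by rewrite /= size_tolist_enc.
exact: den_stage1.
Qed.

(** Restores the initial store that [computes] presupposes for the coalition algorithm. *)
Fixpoint clear_vars (k : nat) : cmd :=
  if k is k'.+1 then Seq (Assign k'.+1 ELeaf) (clear_vars k') else Skip.

Lemma hoare_clear k s : hoare (clear_vars k) s (fun s' =>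
  (forall x, 0 < x -> x <= k -> s' x = Leaf) /\ (forall x, x = 0 \/ k < x -> s' x = s x)) (2 * k + 1).
Proof.
elim: k s => [|k IH] s.
  apply: hoare_skip => //; split=> // x x0; rewrite leqn0 => /eqP x00; by rewrite x00 in x0.
apply: (hoare_seq (n1 := 2) (Q1 := fun s' => s' k.+1 = Leaf /\ forall x, x != k.+1 -> s' x = s x)).
- by apply: hoare_assign => //; split=> [|x xk]; rewrite ?updE // updN.
- move=> s1 [s1k s1x]; apply: hoare_weaken (IH s1) _ (leqnn _) => s2 [h1 h2]; split=> x.
    move=> x0; rewrite leq_eqVlt => /orP[/eqP->|]; last by rewrite ltnS; apply: h1.
    by rewrite h2 //; right.
  move=> hx; rewrite h2; first by apply: s1x; apply/eqP; lia.
  by lia.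
- by lia.
Qed.

(** Reduction, assumed coalition algorithm, test of its answer. The result of the reduction waits in
    [z], beyond the variables of [p]. *)
Definition glue (p1 p p3 : cmd) : cmd :=
  let z := (maxn (maxvar p) (maxvar p3)).+1 in
  Seq p1 (Seq (Assign z (EVar 0)) (Seq (Assign 0 (EHd (EVar 0))) (Seq (clear_vars (maxvar p))
    (Seq p (Seq (Assign 0 (ENode (EVar z) (ENode (EVar 0) ELeaf))) p3))))).

Lemma runs_glue p1 p p3 v st out w n1 t n3 :
  runs p1 v st n1 -> computes p (hd st) out t -> runs p3 (Node st (Node out Leaf)) w n3 ->
  runs (glue p1 p p3) v w (n1 + (t + n3) + 2 * maxvar p + 20).
Proof.
move=> r1 [s' ep so] r3 s sv; rewrite /glue; set z := (maxn _ _).+1.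
have pz : maxvar p < z by rewrite ltnS leq_maxl.
apply: (hoare_weaken (n := n1 + (2 + (3 + (2 * maxvar p + 1 + (t + (6 + n3))))))
  (Q := fun s' => s' 0 = w)) => //; last by lia.
apply: hoare_seq (r1 s sv) _ (leqnn _) => s1 s10.
apply: (hoare_seq (n1 := 2) (Q1 := fun s => s 0 = st /\ s z = st)) (leqnn _).
  by apply: hoare_assign => //; rewrite updE updN //= s10.
move=> s2 [s20 s2z].
apply: (hoare_seq (n1 := 3) (Q1 := fun s => s 0 = hd st /\ s z = st)) (leqnn _).
  by apply: hoare_assign => //; rewrite updE updN //= s20.
move=> s3 [s30 s3z].
apply: hoare_seq (hoare_clear _ s3) _ (leqnn _) => s4 [h1 h2].
have s40 : s4 0 = hd st by rewrite h2 //; left.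
have s4z : s4 z = st by rewrite h2 //; right.
apply: (hoare_seq (n1 := t) (Q1 := fun s => s 0 = out /\ s z = st)) (leqnn _).
  have agree x : x <= maxvar p -> update (fun _ => Leaf) 0 (hd st) x = s4 x.
    case: x => [|x] xp; first by rewrite updE.
    by rewrite updN // h1.
  have [s5 e5 a5] := exec_agree ep (leqnn _) agree.
  exists s5, t; split=> //; split; first by rewrite -a5.
  by rewrite (exec_frame e5).
move=> s6 [s60 s6z].
apply: (hoare_seq (n1 := 6) (Q1 := fun s => s 0 = Node st (Node out Leaf))) (leqnn _).
  by apply: hoare_assign => //=; rewrite updE s60 s6z.
by move=> s7; apply: r3.
Qed.

(** Bounds the input of the final test. The running time of the algorithm would not do so, because
    of shared subtrees; instead, nonempty disjoint blocks leave room for at most [n] entries and [n]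
    blocks. *)
Lemma tree_size_represents n out (P : {set {set 'I_n}}) : represents out P ->
  tree_size out <= (n * (n.*2 + 4)).+1.
Proof.
move=> [s [-> us s0 _]].
have szf : size (flatten s) <= n.
  by rewrite -(card_uniqP us); apply: leq_trans (max_card _) _; rewrite card_ord.
rewrite tree_size_enc_seq ltnS; apply: leq_trans (leq_mul szf (leqnn _)).
rewrite size_flatten /shape sumnE big_map big_distrl /= !big_seq; apply: leq_sum => b bs.
apply: leq_trans (_ : (size b * (n.*2 + 2)).+2 <= _).
  rewrite ltnS; apply: tree_size_enc_seq_le => x _; rewrite tree_size_enc_nat.
  by have := ltn_ord x; lia.
have b0 : 0 < size b by case: b bs s0 => // ->.
move: (size b) b0 => k b0; rewrite -muln2; nia.
Qed.

Lemma tree_size_cnf3 n (phi : cnf3 n) : (tree_size (enc_cnf3 phi)).+1 <= (n + size phi).+2 ^ 7.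
Proof.
set P := (n + size phi).+2.
have lit (l : literal n) : tree_size (enc_literal l) < n.*2 + 6.
  by rewrite /= tree_size_enc_nat; have := tree_size_bool l.1; have := ltn_ord l.2; lia.
have cl (c : clause n) : tree_size (enc_seq (@enc_literal n) c) < (3 * (n.*2 + 6)).+2.
  have := @tree_size_enc_seq_le _ (@enc_literal n) c _ (fun l _ => lit l).
  by rewrite size_tuple ltnS.
have h : tree_size (enc_seq (fun c : clause n => enc_seq (@enc_literal n) c) phi) <=
   (size phi * (3 * (n.*2 + 6)).+2).+1.
  by apply: tree_size_enc_seq_le => c _; apply: cl.
apply: (@leq_trans (P ^ 2 * 2 ^ 5)); last by rewrite (expnD P 2 5) leq_mul2l leq_exp2r // orbT.
rewrite /= tree_size_enc_nat expnS expn1; move: h; set t := tree_size _ => h.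
have : size phi * (3 * (n.*2 + 6)).+2 <= P * (6 * P + 14) by apply: leq_mul; rewrite /P; lia.
move: h; move: (size phi * _) => z h1 h2; rewrite -muln2.
have nP : n.+2 <= P by rewrite /P; lia.
move: P nP h2 => P nP h2; nia.
Qed.

(** * Bounds on the capacity and the cover number *)

Section ParamBounds.

Variables (n : nat) (phi : cnf3 n).
Local Notation m := (size phi).
Local Notation g := (gsz m).
Local Notation q := (2 ^ gsz m).
Local Notation G := (red_graph phi (gsz_gt0 m)).

Lemma gsz_le_q : g <= q. Proof. by apply: ltnW; apply: ltn_expl. Qed.

Lemma q_cube : q * (q * q) <= 8 + m.
Proof. by have [_ + _] := gsz_bounds m; rewrite (expnS _ 2) (expnS _ 1) expn1. Qed.

Lemma m_cube : m <= 8 * (q * (q * q)).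
Proof.
have [_ _ /ltnW] := gsz_bounds m; rewrite (expnS _ 2) (expnS _ 1) expn1 expnS.
by move: (2 ^ g) => x; lia.
Qed.

(** [gD] equals [10 * g * q + 2 * q + 1], which is at most [13 * g * q]. *)
Lemma gC_le : gC g <= 52 * (g * q).
Proof.
rewrite /gC /gD /gW /gU; have := gsz_gt0 m; have : 0 < q by rewrite expn_gt0.
move: (2 ^ g) (gsz m) => x y; nia.
Qed.

Lemma g_vc_le : g * vc G <= 12 * (m + g * q).
Proof.
have := vc_red_graph phi (gsz_gt0 m); have := nb_lt phi (gsz_gt0 m); rewrite /block_copies.
move: (2 ^ g) (gsz m) (vc _) (nb _ _) => x y z w; nia.
Qed.

Lemma gsz_sq : g * g <= 8 + m.
Proof.
apply: leq_trans q_cube; have := gsz_le_q; have : 0 < q by rewrite expn_gt0.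
move: (2 ^ g) (gsz m) => x y; nia.
Qed.

(** The sum is at most [12 * m + 12 * (g * q) + 52 * (g * (g * q))], and both products are at most
    [8 + m] since [g <= q]. So 76 is [12 + 12 + 52] and 512 is [8 * 64]. *)
Lemma g_param_le : g * (vc G + gC g) <= 76 * m + 512.
Proof.
have h1 := gC_le; have h2 := g_vc_le; have h3 := q_cube; have h4 := gsz_le_q; have h5 := gsz_gt0 m.
have h6 : g * (g * q) <= 8 + m by apply: leq_trans h3; rewrite !leq_mul.
have h7 : g * q <= 8 + m by apply: leq_trans h6; rewrite leq_pmull.
rewrite mulnDr; have h8 : g * gC g <= 52 * (g * (g * q)) by rewrite mulnCA leq_mul2l h1 orbT.
move: h2 h6 h7 h8; move: (g * (g * q)) (g * q) (g * gC g) (g * vc G) => a b c d; lia.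
Qed.

(** Here [g] must not be too small: [m <= 8 * q ^ 3] makes the cover number polynomial in [q]. The
    product is at most [52 * 108 * q ^ 5], with [52 * 108 <= 2 ^ 13]. *)
Lemma base_le : maxn 2 (gC g * vc G) <= 2 ^ (19 * g).
Proof.
have g0 := gsz_gt0 m; rewrite geq_max; apply/andP; split.
  by rewrite -{1}(expn1 2) leq_exp2l // muln_gt0.
have h1 : gC g <= 52 * (q * q) by apply: leq_trans gC_le _; rewrite leq_mul2l leq_mul // gsz_le_q.
have h2 : vc G <= 108 * (q * (q * q)).
  have h : vc G <= 12 * (m + g * q) by apply: leq_trans g_vc_le; rewrite leq_pmull.
  have h3 : g * q <= q * (q * q).
    by apply: leq_mul; [apply: gsz_le_q|rewrite leq_pmull // expn_gt0].
  by have := m_cube; move: h h3; move: (q * (q * q)) (g * q) => a b; lia.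
apply: leq_trans (leq_mul h1 h2) _.
rewrite mulnACA (_ : q * q * (q * (q * q)) = q ^ 5); last first.
  by rewrite (expnS _ 4) (expnS _ 3) (expnS _ 2) (expnS _ 1) expn1 -!mulnA.
rewrite (_ : 19 * g = 13 * g + 6 * g); last by lia.
rewrite expnD; apply: leq_mul.
  apply: (@leq_trans (2 ^ 13)) => //; rewrite leq_exp2l //; lia.
by rewrite -expnM leq_exp2l // mulnC leq_mul2r orbT.
Qed.

End ParamBounds.

Lemma sq_le_exp2 u : u * u <= 2 * 2 ^ u.
Proof.
elim: u => // u IH; have : u < 2 ^ u by apply: ltn_expl.
by rewrite expnS; move: (2 ^ u) IH => x; nia.
Qed.

(** [g] stands for [gsz m] and [y] for [vc + C], which [n + m] alone does not determine. The maximum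
    runs over all values allowed by [g_param_le] and [gsz_sq]; the last term pays for polynomial
    factors. *)
Definition red_exponent (f : nat -> nat) (c N : nat) : nat :=
  \max_(g < N + 9) \max_(y < 76 * N + 513 | (g * y <= 76 * N + 512) && (g * g <= 8 + N))
    (19 * (g * f y))
  + c * up_log 2 N.+2.

Lemma little_o_red_exponent f c : little_o f id -> little_o (red_exponent f c) id.
Proof.
(* 38 is twice 19, to stay below half of [N]; 100 leaves room above the [76 + 1] copies of [N] that
   arise below. *)
move=> of_ k; pose K := 100 * (38 * k).
have [N1 hN1] := of_ K; pose A := \max_(x < N1) f x; pose Z := K * A.
have fK x : K * f x <= x + Z.
  have [x1|x1] := leqP N1 x; first by apply: leq_trans (hN1 x x1) (leq_addr _ _).
  apply: leq_trans (leq_addl _ _); rewrite leq_mul2l; apply/orP; right.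
  exact: (leq_bigmax (Ordinal x1)).
pose c' := k * c.
exists (528 + Z * Z + (32 * (c' * c') + 10)) => N hN; rewrite /red_exponent /id.
set M1 := (X in _ * (X + _)); set u := up_log 2 N.+2.
have h1 : k * M1 * 2 <= N.
  suff : M1 * (38 * k) <= 19 * N by lia.
  rewrite /M1; elim/big_ind: _ => [//|a b ha hb|g _]; first by rewrite maxnMl geq_max ha hb.
  elim/big_ind: _ => [//|a b ha hb|y /andP[gy gg]]; first by rewrite maxnMl geq_max ha hb.
  suff : g * (K * f y) <= 100 * N by rewrite /K; move: (f y) (val g) => a b; nia.
  apply: leq_trans (leq_mul (leqnn _) (fK y)) _; rewrite mulnDr.
  (* The product is at most the square of the larger factor: [g * g] is bounded by the side
     condition, and [Z * Z] is constant. *)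
  have gZ : g * Z <= 8 + N + Z * Z.
    have [gle|zlt] := leqP Z g.
      by apply: leq_trans (leq_mul (leqnn g) gle) (leq_trans gg (leq_addr _ _)).
    by apply: leq_trans (leq_mul (ltnW zlt) (leqnn Z)) (leq_addl _ _).
  by move: gy gZ hN; move: (g * y) (g * Z) (Z * Z) (c' * c') => a b d e; lia.
have h2 : c' * u * 2 <= N.
  have ub : 2 ^ u <= 2 * N.+2.
    have : 1 < N.+2 by [].
    move=> /(up_log_bounds (isT : 1 < 2)) /andP[+ _]; rewrite -/u => lt.
    have u0 : 0 < u by rewrite up_log_gt0.
    by rewrite -(prednK u0) expnS leq_mul2l ltnW.
  have := sq_le_exp2 u => su.
  have uu : u * u <= 4 * N + 8 by apply: leq_trans su _; lia.
  (* Either [16 * c' * u <= u * u], which is linear in [N], or [u] is below a constant and the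
     threshold on [N] covers [32 * (c' * c')]. *)
  have [le|lt] := leqP (16 * c') u; first by have := leq_mul le (leqnn u); nia.
  have := leq_mul (leqnn (c' * 2)) (ltnW lt); move: hN; nia.
move: h1 h2; rewrite /c'; nia.
Qed.

Lemma red_exponent_ge f c N g y : g * y <= 76 * N + 512 -> g * g <= 8 + N -> 0 < g ->
  19 * (g * f y) + c * up_log 2 N.+2 <= red_exponent f c N.
Proof.
move=> gy gg g0; rewrite leq_add2r.
have gN : g < N + 9.
  by have : g <= g * g; [rewrite leq_pmull|lia].
have yN : y < 76 * N + 513.
  by have : y <= g * y; [rewrite leq_pmull|lia].
apply: leq_trans (leq_bigmax (Ordinal gN)).
apply: (@leq_bigmax_cond _ _ (fun y : 'I_(76 * N + 513) => 19 * (g * f y)) (Ordinal yN)).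
by rewrite gy gg.
Qed.

Lemma nverts_le (G : graph) C : nverts G <= tree_size (enc_instance G C).
Proof.
rewrite /=; have := size_tolist (enc_seq (fun x => enc_seq (fun y => enc_bool (adj G x y))
  (enum 'I_(nverts G))) (enum 'I_(nverts G))).
by rewrite size_tolist_enc size_enum_ord; lia.
Qed.

Theorem theorem1p4 :
  ETH ->
  ~ exists (p : cmd) (f : nat -> nat) (d : nat),
      little_o f id /\ solves_coalition p (coalition_time f d).
Proof.
move=> eth [p [f [d [of_ solve]]]]; apply: eth.
have [p1 [d1 P1]] := polyf_stage1; have [p3 [d3 P3]] := polyf_den t_check.
pose D1 := (d1 + ((d1 + 2) * d + (2 * d1 + 4) * d3).+1).+1.
pose D2 := (D1 + (2 * maxvar p + 20)).+1.
(* The 7 is the exponent in [tree_size_cnf3]: a power [D2] of the formula size is at most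
   [2 ^ (7 * D2 * up_log 2 (n + m).+2)]. *)
exists (glue p1 p p3), (red_exponent f (7 * D2)); split; first exact: little_o_red_exponent.
move=> n phi; set m := size phi; pose g := gsz m; pose G := red_graph phi (gsz_gt0 m).
have [x ex] := tree_sizeS (enc_cnf3 phi).
have [] := P1 (enc_cnf3 phi); rewrite ex stage1E -/m -/g -/G.
set T := target _ _ _ _ _ _ => r1 s1.
have C0 : 0 < gC g by [].
have [out [t [comp tle [P optP repP]]]] := solve G (gC g) C0.
have [r3 _] := P3 (Node (Node (enc_instance G (gC g)) (enc_nat (2 * T))) (Node out Leaf)).
rewrite (den_check _ _ repP) (red_graph_correct optP) in r3.
set st := Node _ _ in s1 r1 r3.
have a0 : 0 < x.+2 ^ d1 by rewrite expn_gt0.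
have nv : nverts G <= x.+2 ^ d1.
  apply: leq_trans (nverts_le G (gC g)) (leq_trans _ s1).
  exact: leqW (leq_addr _ _).
have so := tree_size_represents repP.
have Y : (tree_size (Node st (Node out Leaf))).+1 <= x.+2 ^ (2 * d1 + 4).
  rewrite expnD mulnC; apply: (@leq_trans (2 ^ 4 * x.+2 ^ (2 * d1))); last first.
    by rewrite leq_mul2r leq_exp2r // orbT.
  rewrite mul2n -addnn expnD.
  have so' : tree_size out <= (x.+2 ^ d1 * (x.+2 ^ d1 * 2 + 4)).+1.
    by apply: leq_trans so _; rewrite ltnS leq_mul // -muln2 leq_add2r leq_mul2r nv.
  move: a0 s1 so'; rewrite /=; move: (x.+2 ^ d1) (tree_size _) (tree_size _) => a b e; nia.
have Y3 : (tree_size (Node st (Node out Leaf))).+1 ^ d3 <= x.+2 ^ ((2 * d1 + 4) * d3).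
  by have [->|d30] := posnP d3; rewrite ?muln0 // expnM leq_exp2r.
have Vd : (nverts G).+2 ^ d <= x.+2 ^ ((d1 + 2) * d).
  have [->|d0] := posnP d; first by rewrite muln0.
  rewrite expnM leq_exp2r // expnD; apply: (@leq_trans (x.+2 ^ d1 * 2 ^ 2)); first by lia.
  by rewrite leq_mul2l leq_exp2r // orbT.
pose y := vc G + gC g; pose E := 2 ^ (19 * (g * f y)).
have E0 : 0 < E by rewrite expn_gt0.
(* By [base_le] the parameterized factor is at most [E], and the number of vertices is polynomial in
   the formula size. *)
have tle' : t <= E * x.+2 ^ ((d1 + 2) * d).
  apply: leq_trans tle _; rewrite /coalition_time leq_mul // /E mulnA.
  rewrite expnM; have [->|fy] := posnP (f y); first by [].
  by rewrite leq_exp2r //; apply: base_le.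
have total : x.+2 ^ d1 + (t + (tree_size (Node st (Node out Leaf))).+1 ^ d3) + 2 * maxvar p + 20
    <= E * x.+2 ^ D2.
  apply: leq_trans (_ : E * (x.+2 ^ d1 + (x.+2 ^ ((d1 + 2) * d) + x.+2 ^ ((2 * d1 + 4) * d3))
    + (2 * maxvar p + 20)) <= _).
    move: E0 tle' Y3; move: E (x.+2 ^ d1) (x.+2 ^ ((d1 + 2) * d)) (x.+2 ^ ((2 * d1 + 4) * d3)).
    move: (_ ^ d3) => z E' a b e; nia.
  rewrite leq_mul2l; apply/orP; right; apply: leq_polyD; last exact: leq_polyC.
  by apply: leq_polyD => //; apply: leq_polyD.
have bound : E * x.+2 ^ D2 <= 2 ^ red_exponent f (7 * D2) (n + m).
  apply: (@leq_trans (2 ^ (19 * (g * f y) + 7 * D2 * up_log 2 (n + m).+2))); last first.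
    rewrite leq_exp2l //; apply: red_exponent_ge.
    - by apply: leq_trans (g_param_le phi) _; rewrite -/m; lia.
    - by apply: leq_trans (gsz_sq phi) _; rewrite -/m; lia.
    - exact: gsz_gt0.
  rewrite expnD leq_mul2l; apply/orP; right.
  have xN : x.+2 <= 2 ^ (7 * up_log 2 (n + m).+2).
    rewrite -ex; apply: leq_trans (tree_size_cnf3 phi) _.
    by rewrite mulnC expnM leq_exp2r //; apply: up_logP.
  rewrite -mulnA [D2 * _]mulnC mulnA expnM; have D20 : 0 < D2 by [].
  by rewrite leq_exp2r.
have rQ := runs_glue r1 comp r3.
have [s' [t' [e0 w0 le0]]] := rQ (update (fun _ => Leaf) 0 (enc_cnf3 phi)) (updE _ _ _).
exists t'; first by exists s'.
exact: leq_trans le0 (leq_trans total bound).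
Qed.
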